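(* Let $p$ be an odd prime, let $F$ be a field of characteristic $p$ and let $n \in \mathbf{N}$. For every integer $t \ge 0$ such that $t \le n/p$ there is an indecomposable direct summand of the $FS_{2n}$-module $H^{(2^n)}$ with vertex $Q_t$.
   Context: $H^{(2^n)}$ is the permutation module over $F$ of the symmetric group $S_{2n}$ acting on the set partitions of $\{1,\ldots,2n\}$ into $n$ sets each of size $2$; equivalently it is the $FS_{2n}$-module induced from the trivial representation of the imprimitive wreath product $S_2 \wr S_n \le S_{2n}$. For $t \ge 1$, $Q_t$ denotes a Sylow $p$-subgroup of $S_2 \wr S_{tp} \le S_{2tp}$, where $S_{2tp}$ is regarded as the subgroup of $S_{2n}$ fixing $2tp+1,\ldots,2n$; $Q_0$ is the trivial group. *)

(* Defs.v *)
From mathcomp Require Import all_boot all_fingroup all_algebra all_solvable.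
From mathcomp Require Import mxrepresentation.

Set Implicit Arguments.
Unset Strict Implicit.
Unset Printing Implicit Defensive.

Import GroupScope GRing.Theory.
Local Open Scope ring_scope.

(* Modules are right modules of row vectors, as in mxrepresentation. *)

Section PermRepr.

Variables (F : fieldType) (gT : finGroupType) (T : finType).
Variables (G : {group gT}) (to : {action gT &-> T}) (S : {set T}).
Hypothesis actsGS : [acts G, on S | to].

Definition perm_repr_mx (g : gT) : 'M[F]_#|S| :=
  \matrix_(i, j) (to (enum_val i) g == enum_val j)%:R.

Lemma perm_repr_mx_repr : mx_repr G perm_repr_mx.
Proof.
split=> [|x y Gx Gy]; apply/matrixP=> i j; rewrite !mxE.
  by rewrite act1 (inj_eq enum_val_inj).
have Sx : to (enum_val i) x \in S by rewrite (acts_act actsGS) ?enum_valP.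
pose k0 := enum_rank_in Sx (to (enum_val i) x).
have k0E : enum_val k0 = to (enum_val i) x by rewrite enum_rankK_in.
rewrite (bigD1 k0) //= big1 => [|k nk]; rewrite !mxE.
  by rewrite k0E eqxx mul1r addr0 actM.
by rewrite -k0E (inj_eq enum_val_inj) eq_sym (negPf nk) mul0r.
Qed.

Definition perm_repr := MxRepresentation perm_repr_mx_repr.

End PermRepr.

(* The induced module N (x)_{FH} FG, on the decomposition into the N (x) t_i   *)
(* with t_i running over representatives of the right cosets of H in G:       *)
(* (v (x) t_i) g = v h (x) t_j where t_i g = h t_j with h in H.               *)
Section IndRepr.

Variables (F : fieldType) (gT : finGroupType) (G H : {group gT}).
Hypothesis sHG : H \subset G.
Variables (d : nat) (rN : mx_representation F H d).

Definition coset_rep (i : 'I_#|rcosets H G|) : gT := repr (enum_val i).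

Definition ind_block (g : gT) (i j : 'I_#|rcosets H G|) : 'M[F]_d :=
  let h := (coset_rep i * g * (coset_rep j)^-1)%g in
  if h \in H then rN h else 0.

Definition ind_mx (g : gT) : 'M[F]_(\sum_(i < #|rcosets H G|) d) :=
  \mxblock_(i, j) ind_block g i j.

Lemma coset_repE i : H :* coset_rep i = enum_val i.
Proof.
have /rcosetsP[x _ defi] := enum_valP i.
by rewrite /coset_rep defi rcoset_repr.
Qed.

Lemma coset_rep_in i : coset_rep i \in G.
Proof.
have /rcosetsP[x Gx defi] := enum_valP i.
rewrite /coset_rep defi; have := mem_repr_rcoset H x.
by case/rcosetP=> h Hh ->; rewrite groupM // (subsetP sHG).
Qed.

Lemma coset_repP i j g :
  (coset_rep i * g * (coset_rep j)^-1 \in H)%g = (H :* (coset_rep i * g) == enum_val j).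
Proof. by rewrite -mem_rcoset -coset_repE; apply/rcoset_eqP/eqP. Qed.

Lemma ind_mx_repr : mx_repr G ind_mx.
Proof.
split=> [|x y Gx Gy].
  rewrite -mxdiagZ /ind_mx /mxdiag; apply/eq_mxblock=> i j; rewrite /ind_block coset_repP mulg1.
  rewrite coset_repE (inj_eq enum_val_inj); case: eqP => [<-|//].
  by rewrite conform_mx_id mulgV repr_mx1.
rewrite /ind_mx mul_mxblock; apply/eq_mxblock=> i j.
have Gix : (coset_rep i * x \in G)%g by rewrite groupM ?coset_rep_in.
have Rix : H :* (coset_rep i * x) \in rcosets H G by apply/rcosetsP; exists (coset_rep i * x)%g.
pose k0 := enum_rank_in Rix (H :* (coset_rep i * x)).
have k0E : enum_val k0 = H :* (coset_rep i * x) by rewrite enum_rankK_in.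
have hk0 : (coset_rep i * x * (coset_rep k0)^-1 \in H)%g by rewrite coset_repP k0E.
rewrite (bigD1 k0) //= big1 => [|k nk]; last first.
  by rewrite /ind_block coset_repP -k0E (inj_eq enum_val_inj) eq_sym (negPf nk) mul0mx.
rewrite addr0 /ind_block hk0.
have -> : (coset_rep i * (x * y) * (coset_rep j)^-1 =
  (coset_rep i * x * (coset_rep k0)^-1) * (coset_rep k0 * y * (coset_rep j)^-1))%g.
  by rewrite !mulgA mulgKV.
rewrite groupMl //; case: ifP => [h2|_]; last by rewrite mulmx0.
by rewrite repr_mxM.
Qed.

End IndRepr.

Definition ind_repr (F : fieldType) (gT : finGroupType) (G H : {group gT})
    (sHG : H \subset G) (d : nat) (rN : mx_representation F H d) :
    mx_representation F G (\sum_(i < #|rcosets H G|) d) :=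
  MxRepresentation (ind_mx_repr sHG rN).

(* A Prop version of mxsplits rV 1%:M U, which lives in Type. *)
Definition direct_summand (F : fieldType) (gT : finGroupType) (G : {group gT})
    (m : nat) (rV : mx_representation F G m) (U : 'M[F]_m) : Prop :=
  exists W : 'M[F]_m,
    [/\ mxmodule rV W, (U + W :=: 1%:M)%MS & mxdirect (U + W)].

Section Vertex.

Variables (F : fieldType) (gT : finGroupType) (G : {group gT}) (n : nat).
Variable rM : mx_representation F G n.

Definition indecomposable : Prop :=
  (0 < n)%N /\
  forall U V : 'M[F]_n,
    mxmodule rM U -> mxmodule rM V -> (U + V :=: 1%:M)%MS -> mxdirect (U + V) ->
    U = 0 \/ V = 0.

Definition is_summand_of m (rV : mx_representation F G m) : Prop :=
  exists (U : 'M[F]_m) (modU : mxmodule rV U),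
    direct_summand rV U /\ mx_rsim (submod_repr modU) rM.

Definition relatively_projective (H : {group gT}) : Prop :=
  exists (sHG : H \subset G) (d : nat) (rN : mx_representation F H d),
    is_summand_of (ind_repr sHG rN).

Definition is_vertex (Q : {group gT}) : Prop :=
  relatively_projective Q /\
  forall R : {group gT}, R \subset Q -> relatively_projective R -> R :=: Q.

End Vertex.

Section Foulkes.

Variable n : nat.

Definition pair_partitions : {set {set {set 'I_(2 * n)}}} :=
  [set P : {set {set 'I_(2 * n)}} | partition P [set: 'I_(2 * n)] &
    [forall B in P, #|B| == 2%N]].

Lemma acts_pair_partitions :
  [acts [set: 'S_(2 * n)], on pair_partitions | ('P^*^*)%act].
Proof.
apply/subsetP=> s _; rewrite !inE /=; apply/subsetP=> P; rewrite !inE.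
case/andP=> /and3P[/eqP covP tIP n0P] /forall_inP cP.
have imP (C : {set 'I_(2 * n)}) : ('P^*)%act C s = s @: C.
  by apply: eq_imset => x; apply: apermE.
have imPP : ('P^*^*)%act P s = (fun C : {set 'I_(2 * n)} => s @: C) @: P.
  by apply: eq_imset => C; rewrite imP.
rewrite imPP; apply/andP; split; last first.
  by apply/forall_inP=> _ /imsetP[B PB ->]; rewrite card_imset ?cP //; apply: perm_inj.
apply/and3P; split.
- rewrite cover_imset eqEsubset subsetT; apply/subsetP=> x _.
  have : (s^-1)%g x \in cover P by rewrite covP.
  case/bigcupP=> B PB Bx; apply/bigcupP; exists B => //.
  by apply/imsetP; exists ((s^-1)%g x); rewrite ?permKV.
- apply/trivIsetP=> _ _ /imsetP[B PB ->] /imsetP[C PC ->] nBC.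
  rewrite imset_disjoint; last exact: perm_inj.
  by apply: (trivIsetP tIP) => //; apply: contra nBC => /eqP->.
apply/imsetP=> -[B PB] /esym/eqP; rewrite imset_eq0 => /eqP B0.
by rewrite -B0 PB in n0P.
Qed.

Definition foulkes_repr (F : fieldType) :
    mx_representation F [set: 'S_(2 * n)]%G #|pair_partitions| :=
  perm_repr F (G := [set: 'S_(2 * n)]%G) acts_pair_partitions.

(* The imprimitive wreath product S_2 wr S_m inside the symmetric group on    *)
(* the first 2m of the points 0, ..., 2n-1 (meaningful for m <= n), the base  *)
(* copies of S_2 acting on {0, 1}, {2, 3}, ..., {2m-2, 2m-1}: its elements    *)
(* send 2 i + b to 2 sigma(i) + tau_i(b).                                     *)
Definition wreath_elt m (sigma : 'S_m) (tau : {ffun 'I_m -> 'S_2})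
    (s : 'S_(2 * n)) : bool :=
  [forall x : 'I_(2 * n), forall i : 'I_m, forall b : 'I_2,
     (x == 2 * i + b :> nat)%N ==> (s x == 2 * sigma i + tau i b :> nat)%N].

Definition wreath_S2 m : {set 'S_(2 * n)} :=
  [set s : 'S_(2 * n) | perm_on [set x : 'I_(2 * n) | (x < 2 * m)%N] s &
    [exists sigma : 'S_m, exists tau : {ffun 'I_m -> 'S_2},
      wreath_elt sigma tau s]].

Lemma wreath_S2_group_set m : group_set (wreath_S2 m).
Proof.
apply/group_setP; split.
  rewrite inE perm_on1; apply/existsP; exists 1%g; apply/existsP.
  exists [ffun=> 1%g]; apply/forallP=> x; apply/forallP=> i; apply/forallP=> b.
  by apply/implyP=> /eqP xE; rewrite ffunE !perm1 xE.
move=> s s' /setIdP[ons /existsP[sg /existsP[ta /forallP sE]]].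
case/setIdP=> [ons' /existsP[sg' /existsP[ta' /forallP sE']]].
rewrite inE perm_onM //; apply/existsP; exists (sg * sg')%g; apply/existsP.
exists [ffun i => (ta i * ta' (sg i))%g].
apply/forallP=> x; apply/forallP=> i; apply/forallP=> b; apply/implyP=> xE.
have /forallP/(_ i)/forallP/(_ b)/implyP/(_ xE) sxE := sE x.
have /forallP/(_ (sg i))/forallP/(_ (ta i b))/implyP/(_ sxE) sxE' := sE' (s x).
by rewrite ffunE !permM.
Qed.

Canonical wreath_S2_group m := Group (wreath_S2_group_set m).

Definition is_Qt (p t : nat) (Q : {group 'S_(2 * n)}) : Prop :=
  if t is 0 then Q :=: 1%g else p.-Sylow(wreath_S2 (t * p)) Q.

End Foulkes.

(* Main.v *)
(* Let G = S_2n act on the set Omega of pair partitions, M = F[Omega], and let W be S_2 wr S_tp acting on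
   the first 2tp points, with Sylow p-subgroup Q. Endomorphisms of M are the G-invariant functions on
   Omega x Omega, and restricting them to the Q-fixed points is multiplicative modulo p (the Brauer
   morphism) and kills every relative trace from a proper subgroup of Q. Hence a relative trace a from Q
   whose restriction is not nilpotent yields, by Fitting's lemma and a choice of minimal rank, a primitive
   idempotent cutting out a summand with vertex Q.

   For the pair partitions extending the standard pairing of the first 2tp points, take the relative trace
   from W of a part of an S_2m-invariant kernel c on the matchings of the other 2m points (m = n - tp). It
   restricts to c, so it remains to find c that is not nilpotent and vanishes at (P, S) whenever p divides
   the order of the stabiliser of (P, S); this second condition makes c a trace from the trivial group.
   Let B(P, S) count the words with prescribed content that are constant on the pairs of P and of S. Then
   c = B^2 vanishes as required, because modulo p one may restrict to triples (word, matching, word) fixed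
   by an element g of order p, and a single cycle of g permutes those freely.

   Finally B has, on the antisymmetrised vector of shape 2 lambda, the eigenvalue E(prod_c Delta_c^2), where
   c runs over the column lengths of lambda, Delta_c is the leading c x c minor of a matrix of independent
   standard Gaussians, and E is the formal expectation (Wick's formula). A Capelli-type recursion
   evaluates it as the product of the hook numbers 2 a(s) + l(s) + 1 over the boxes s of lambda, and every
   size m admits a lambda for which all of them are prime to p. *)

Require Import Defs.
From mathcomp Require Import all_boot all_fingroup all_algebra all_solvable.
From mathcomp Require Import mxrepresentation.
From mathcomp Require Import ring zify.
From HB Require Import structures.
From mathcomp Require Import ssrcomplements mpoly.
From Stdlib Require Import Classical_Prop.

Set Implicit Arguments.
Unset Strict Implicit.
Unset Printing Implicit Defensive.

Import GroupScope GRing.Theory.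
Local Open Scope ring_scope.

(** * Relative projectivity and relative traces *)

Section RelativeProjectivity.

Variables (F : fieldType) (gT : finGroupType) (G : {group gT}).

Definition intertwines n1 n2 (r1 : mx_representation F G n1)
    (r2 : mx_representation F G n2) (f : 'M_(n1, n2)) :=
  forall x, x \in G -> r1 x *m f = f *m r2 x.

Lemma intertwinesM n1 n2 n3 (r1 : mx_representation F G n1)
    (r2 : mx_representation F G n2) (r3 : mx_representation F G n3) f g :
  intertwines r1 r2 f -> intertwines r2 r3 g -> intertwines r1 r3 (f *m g).
Proof. by move=> hf hg x Gx; rewrite mulmxA hf // -!mulmxA hg. Qed.

Lemma intertwines_mxmodule n1 n (r1 : mx_representation F G n1)
    (r : mx_representation F G n) f :
  intertwines r1 r f -> mxmodule r f.
Proof. by move=> hf; apply/mxmoduleP=> x Gx; rewrite -hf // submxMl. Qed.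

Lemma intertwines_val n (r : mx_representation F G n) (U : 'M_n)
    (modU : mxmodule r U) :
  intertwines (submod_repr modU) r (val_submod 1%:M).
Proof. by move=> x Gx; rewrite -val_submodE -{1}(mul1mx (submod_repr _ x)) val_submodJ. Qed.

Lemma intertwines_in n n1 (r : mx_representation F G n) (U : 'M_n)
    (modU : mxmodule r U) (r1 : mx_representation F G n1) (f : 'M_(n1, n)) :
  intertwines r1 r f -> (f <= U)%MS ->
  intertwines r1 (submod_repr modU) (in_submod U f).
Proof.
move=> hf sfU x Gx; rewrite -in_submodJ // -hf // !(in_submodE _ f) //.
by rewrite mulmxA -in_submodE.
Qed.

Lemma idem_direct_summand n (r : mx_representation F G n) (e : 'M_n) :
  intertwines r r e -> e *m e = e -> direct_summand r e.
Proof.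
move=> he ee; exists (1%:M - e); split.
- apply: (@intertwines_mxmodule _ _ r) => x Gx.
  by rewrite mulmxBr mulmxBl mulmx1 mul1mx he.
- apply/eqmxP; rewrite submx1 /=.
  rewrite -{1}(subrK e 1%:M) addrC addmx_sub ?addsmxSl //.
  exact: addsmxSr.
apply/mxdirect_addsP/eqP; rewrite -submx0.
have /submxP[u defu] : (e :&: (1%:M - e) <= e)%MS := capmxSl _ _.
have /submxP[w defw] : (e :&: (1%:M - e) <= 1%:M - e)%MS := capmxSr _ _.
have -> : (e :&: (1%:M - e))%MS = 0; last by rewrite sub0mx.
have : (e :&: (1%:M - e))%MS *m e = 0.
  by rewrite defw -mulmxA mulmxBl mul1mx ee subrr mulmx0.
by rewrite {1}defu -mulmxA ee -defu.
Qed.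

(** [g *m f] is an idempotent endomorphism of [rV], and [f] maps [rU] isomorphically onto its
    image. *)
Lemma summand_of_retract m nU (rV : mx_representation F G m)
    (rU : mx_representation F G nU) (f : 'M_(nU, m)) (g : 'M_(m, nU)) :
  intertwines rU rV f -> intertwines rV rU g -> f *m g = 1%:M ->
  is_summand_of rU rV.
Proof.
move=> hf hg fg.
pose e := g *m f.
have he : intertwines rV rV e := intertwinesM hg hf.
have ee : e *m e = e by rewrite /e mulmxA -(mulmxA g) fg mulmx1.
exists e, (intertwines_mxmodule he); split; first exact: idem_direct_summand.
apply: mx_rsim_sym.
have sfe : (f <= e)%MS by rewrite -[f]mul1mx -fg -mulmxA submxMl.
have rkf : \rank f = nU.
  apply/eqP; rewrite -[_ == _]/(row_free f) -row_leq_rank.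
  by rewrite -[X in (X <= _)%N](mxrank1 F nU) -fg mxrankM_maxl.
exists (in_submod e f).
- have [sef _] : (e <= f)%MS /\ true by rewrite submxMl.
  by rewrite -rkf; apply/eqP; rewrite eqn_leq !mxrankS.
- by rewrite /row_free mxrank_in_submod // rkf.
exact: intertwines_in.
Qed.

Lemma retract_of_summand m nU (rV : mx_representation F G m)
    (rU : mx_representation F G nU) :
  is_summand_of rU rV ->
  exists (f : 'M_(nU, m)) (g : 'M_(m, nU)),
    [/\ intertwines rU rV f, intertwines rV rU g & f *m g = 1%:M].
Proof.
case=> U [modU [[W [modW defUW dxUW]] sim]].
have dx0 : (U :&: W = 0)%MS by apply/mxdirect_addsP.
have [B [C CB defr]] := mx_rsim_def sim.
have hB : intertwines (submod_repr modU) rU B.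
  by move=> x Gx; rewrite defr // -!mulmxA CB mulmx1.
have hC : intertwines rU (submod_repr modU) C.
  by move=> x Gx; rewrite defr // !mulmxA CB mul1mx.
exists (C *m @val_submod _ _ U _ 1%:M), (in_submod U (proj_mx U W) *m B); split.
- exact/(intertwinesM hC)/intertwines_val.
- apply: (@intertwinesM _ _ _ _ (submod_repr modU)) => //.
  apply: intertwines_in; last by rewrite -[proj_mx _ _]mul1mx proj_mx_sub.
  move=> x Gx; have := proj_mx_hom dx0 modU modW.
  by rewrite defUW => /hom_mxP/(_ x Gx); rewrite !mul1mx.
rewrite mulmxA -(mulmxA C).
have -> : @val_submod _ _ U _ 1%:M *m in_submod U (proj_mx U W)
          = in_submod U (@val_submod _ _ U _ 1%:M *m proj_mx U W).
  by rewrite in_submodE mulmxA -in_submodE.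
by rewrite (proj_mx_id dx0) ?val_submodP // val_submodK mulmx1.
Qed.

(** Higman's relative trace from [H] to [G]. It is meant for [b] commuting with [H], when the choice
    of representatives does not matter. *)
Definition rel_trace n (r : mx_representation F G n) (H : {group gT}) (b : 'M_n) :=
  \sum_(i < #|rcosets H G|) r (coset_rep i)^-1%g *m b *m r (coset_rep i).

Definition commutes_on n (r : mx_representation F G n) (H : {group gT}) (b : 'M_n) :=
  forall h, h \in H -> r h *m b = b *m r h.

(** * Higman's criterion for relative projectivity *)

Section Higman.

Variables (H : {group gT}) (sHG : H \subset G).

Lemma rcoset_index x : x \in G ->
  {i : 'I_#|rcosets H G| | (x * (coset_rep i)^-1)%g \in H}.
Proof.
move=> Gx; have Rx : H :* x \in rcosets H G by apply/rcosetsP; exists x.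
exists (enum_rank_in Rx (H :* x)); rewrite -mem_rcoset.
by rewrite coset_repE // enum_rankK_in // rcoset_refl.
Qed.

Lemma coset_rep_inj (i j : 'I_#|rcosets H G|) x :
  (x * (coset_rep i)^-1)%g \in H -> (x * (coset_rep j)^-1)%g \in H -> i = j.
Proof.
rewrite -!mem_rcoset => /rcoset_eqP xi /rcoset_eqP xj.
by apply: enum_val_inj; rewrite -!coset_repE -xi -xj.
Qed.

(** The module is a retract of [r] restricted to [H] and induced back: [io] sends v to the sum of v
    t^-1 b (x) t over the representatives t, [pi] sends v (x) t to v t, and [io *m pi] is the trace
    of [b], that is [g *m f]. *)
Lemma relatively_projective_of_trace n (r : mx_representation F G n)
    nU (rU : mx_representation F G nU) (f : 'M_(nU, n)) (g : 'M_(n, nU)) b :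
  intertwines rU r f -> intertwines r rU g -> f *m g = 1%:M ->
  commutes_on r H b -> g *m f = rel_trace r H b ->
  relatively_projective rU H.
Proof.
move=> hf hg fg hb gf.
exists sHG, n, (subg_repr r sHG).
set rI := ind_repr _ _.
pose pi : 'M_(\sum_(i < #|rcosets H G|) n, n) := \mxcol_i r (coset_rep i).
pose io : 'M_(n, \sum_(i < #|rcosets H G|) n) :=
  \mxrow_i (r (coset_rep i)^-1%g *m b).
have Gc i : coset_rep i \in G := coset_rep_in sHG i.
have hpi : intertwines rI r pi.
  move=> x Gx; rewrite /rI /= /ind_mx mul_mxblock_mxrow mxcol_mul.
  apply/eq_mxcol=> i.
  have [j hj] := rcoset_index (groupM (Gc i) Gx).
  rewrite (bigD1 j) //= big1 ?addr0 => [|k nk].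
    by rewrite /ind_block hj /= -!repr_mxM ?groupM ?groupV ?mulgKV.
  rewrite /ind_block; case: ifP => [hk|]; last by rewrite mul0mx.
  by rewrite (coset_rep_inj hk hj) eqxx in nk.
have hio : intertwines r rI io.
  move=> x Gx; rewrite /rI /= /ind_mx mul_mxrow_mxblock mul_mxrow.
  apply/eq_mxrow=> j.
  have Gjx : (coset_rep j * x^-1)%g \in G by rewrite groupM ?groupV.
  have [i hi] := rcoset_index Gjx.
  have hi' : (coset_rep i * x * (coset_rep j)^-1)%g \in H.
    by rewrite -groupV !invMg !invgK mulgA.
  rewrite (bigD1 i) //= big1 ?addr0 => [|k nk].
    rewrite /ind_block hi' /= -!mulmxA -hb // !mulmxA.
    by rewrite -!repr_mxM ?groupM ?groupV // !mulgA mulVg mul1g.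
  rewrite /ind_block; case: ifP => [hk|]; last by rewrite mulmx0.
  rewrite -groupV !invMg !invgK mulgA in hk.
  by rewrite (coset_rep_inj hk hi) eqxx in nk.
apply: (@summand_of_retract _ _ _ _ (f *m io) (pi *m g)).
- exact: intertwinesM hf hio.
- exact: intertwinesM hpi hg.
have iopi : io *m pi = g *m f by rewrite gf mul_mxrow_mxcol.
by rewrite -mulmxA (mulmxA io) iopi mulmxA mulmxA fg mul1mx fg.
Qed.

(** For a retract of an induced module, [b] is the part of the retraction passing through the block
    of the trivial coset. Its conjugates are the parts through the other blocks, and these add up to
    the identity. *)
Lemma trace_of_relatively_projective n (r : mx_representation F G n) :
  relatively_projective r H ->
  exists2 b, commutes_on r H b & rel_trace r H b = 1%:M.
Proof.
case=> sHG' [d [rN /retract_of_summand[f [g [hf hg fg]]]]].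
(* [i0] indexes the coset [H] itself; its representative is 1 because [repr] of a group is 1, so [H]
   acts on this block through [rN]. *)
have R1 : 1%g \in G by [].
have [i0 h0] := rcoset_index R1; rewrite mul1g groupV in h0.
have Hrep0 : coset_rep i0 = 1%g.
  by rewrite /coset_rep -(coset_repE i0) (rcoset_id h0) repr_group.
have Gc i : coset_rep i \in G := coset_rep_in sHG i.
have f_col j x : x \in G -> r x *m submxrow f j
    = \sum_i submxrow f i *m ind_block (G := G) rN x i j.
  move=> Gx; have : r x *m f = (\mxrow_i submxrow f i) *m ind_mx G rN x.
    by rewrite submxrowK hf.
  rewrite mul_mxrow_mxblock => /(congr1 (fun M => submxrow M j)).
  by rewrite mxrowK mul_submxrow.
have g_row i x : x \in G -> submxcol g i *m r x
    = \sum_j ind_block (G := G) rN x i j *m submxcol g j.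
  move=> Gx; have : g *m r x = ind_mx G rN x *m (\mxcol_i submxcol g i).
    by rewrite submxcolK -hg.
  rewrite mul_mxblock_mxrow => /(congr1 (fun M => submxcol M i)).
  by rewrite mxcolK submxcol_mul.
exists (submxrow f i0 *m submxcol g i0).
  move=> h Hh; have Gh := subsetP sHG h Hh.
  rewrite mulmxA f_col // -mulmxA g_row // (bigD1 i0) //= (bigD1 i0 (P := predT)) //=.
  rewrite !big1 ?addr0 => [|j nj|i ni].
  - by rewrite !mulmxA.
  - rewrite /ind_block Hrep0 mul1g; case: ifP => [hj|]; last by rewrite mul0mx.
    have hi0 : (h * (coset_rep i0)^-1)%g \in H by rewrite Hrep0 invg1 mulg1.
    by rewrite (coset_rep_inj hj hi0) eqxx in nj.
  rewrite /ind_block Hrep0 invg1 mulg1; case: ifP => [hi|]; last by rewrite mulmx0.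
  rewrite groupMr // in hi.
  have hi' : (1 * (coset_rep i)^-1)%g \in H by rewrite mul1g groupV.
  have hi0 : (1 * (coset_rep i0)^-1)%g \in H by rewrite Hrep0 invg1 mulg1.
  by rewrite (coset_rep_inj hi' hi0) eqxx in ni.
(* The representative of coset [i] carries block [i0] to block [i], so every block of [f] and of [g]
   is a translate of block [i0]. *)
have fE i : submxrow f i = r (coset_rep i)^-1%g *m submxrow f i0.
  have fi0 : r (coset_rep i) *m submxrow f i = submxrow f i0.
    rewrite f_col // (bigD1 i0) //= big1 ?addr0 => [|j nj].
      by rewrite /ind_block Hrep0 mul1g mulgV group1 repr_mx1 mulmx1.
    rewrite /ind_block mulgK; case: ifP => [hj|]; last by rewrite mulmx0.
    have hj' : (1 * (coset_rep j)^-1)%g \in H by rewrite mul1g groupV.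
    have hi0 : (1 * (coset_rep i0)^-1)%g \in H by rewrite Hrep0 invg1 mulg1.
    by rewrite (coset_rep_inj hj' hi0) eqxx in nj.
  by rewrite -fi0 mulmxA -repr_mxM ?groupV // mulVg repr_mx1 mul1mx.
have gE i : submxcol g i = submxcol g i0 *m r (coset_rep i).
  rewrite g_row // (bigD1 i) //= big1 ?addr0 => [|j nj].
    by rewrite /ind_block Hrep0 mul1g mulgV group1 repr_mx1 mul1mx.
  rewrite /ind_block Hrep0 mul1g; case: ifP => [hj|]; last by rewrite mul0mx.
  have hi : (coset_rep i * (coset_rep i)^-1)%g \in H by rewrite mulgV.
  by rewrite (coset_rep_inj hj hi) eqxx in nj.
have fgE : f *m g = \sum_i submxrow f i *m submxcol g i.
  by rewrite -mul_mxrow_mxcol submxrowK submxcolK.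
rewrite -fg fgE /rel_trace; apply: eq_bigr => i _.
by rewrite [in RHS]fE [in RHS]gE !mulmxA.
Qed.

End Higman.

End RelativeProjectivity.

(** * Calculus of relative traces *)

Section RelativeTrace.

Variables (F : fieldType) (gT : finGroupType) (G : {group gT}) (n : nat).
Variable r : mx_representation F G n.

Definition conj_mx (b : 'M[F]_n) (g : gT) := r g^-1%g *m b *m r g.

Lemma rel_traceE (H : {group gT}) b :
  rel_trace r H b = \sum_(A in rcosets H G) conj_mx b (repr A).
Proof. by rewrite big_enum_val. Qed.

Lemma conj_mxMl (H : {group gT}) b h g : H \subset G -> commutes_on r H b ->
  h \in H -> g \in G -> conj_mx b (h * g) = conj_mx b g.
Proof.
move=> sHG hb Hh Gg; have Gh := subsetP sHG h Hh.
rewrite /conj_mx invMg !repr_mxM ?groupV // -!mulmxA; congr (_ *m _).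
rewrite !mulmxA; congr (_ *m _); rewrite -mulmxA -hb // mulmxA -repr_mxM ?groupV //.
by rewrite mulVg repr_mx1 mul1mx.
Qed.

Lemma rcosets_repr (H : {group gT}) A : H \subset G -> A \in rcosets H G ->
  repr A \in G /\ A = H :* repr A.
Proof.
move=> sHG /rcosetsP[x Gx ->]; rewrite rcoset_repr; split=> //.
by have /rcosetP[h Hh ->] := mem_repr_rcoset H x; rewrite groupM // (subsetP sHG).
Qed.

Lemma conj_mx_repr (H : {group gT}) b x : H \subset G -> commutes_on r H b ->
  x \in G -> conj_mx b (repr (H :* x)) = conj_mx b x.
Proof.
move=> sHG hb Gx; have /rcosetP[h Hh ->] := mem_repr_rcoset H x.
exact: conj_mxMl hb Hh Gx.
Qed.

Lemma rel_trace_commutes (H : {group gT}) b : H \subset G ->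
  commutes_on r H b -> intertwines r r (rel_trace r H b).
Proof.
move=> sHG hb x Gx; rewrite rel_traceE mulmx_sumr mulmx_suml.
rewrite [RHS](reindex_inj (act_inj 'Rs x^-1%g)) /=.
apply: eq_big => [A|A RA].
  by rewrite (acts_act (actsRs_rcosets H G)) ?groupV.
have [GA defA] := rcosets_repr sHG RA.
have -> : 'Rs%act A x^-1%g = H :* (repr A * x^-1) by rewrite [LHS]rcosetE rcosetM -defA.
rewrite conj_mx_repr ?groupM ?groupV //.
rewrite /conj_mx invMg invgK !repr_mxM ?groupV // -!mulmxA.
by rewrite -repr_mxM ?groupV // mulVg repr_mx1 mulmx1.
Qed.

(** Each right coset of [H] is a union of [#|H : Q|] right cosets of [Q], all giving the same
    conjugate of [b]. Used to rewrite a trace from a group as a trace from its Sylow subgroup. *)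
Lemma rel_trace_trans (Q H : {group gT}) b : Q \subset H -> H \subset G ->
  commutes_on r H b -> rel_trace r Q b = #|H : Q|%:R *: rel_trace r H b.
Proof.
move=> sQH sHG hb; have sQG := subset_trans sQH sHG.
rewrite !rel_traceE (partition_big (fun A => H :* repr A) (mem (rcosets H G))) /=.
  rewrite scaler_sumr; apply: eq_bigr => B RB.
  have [GB defB] := rcosets_repr sHG RB.
  rewrite (eq_bigr (fun=> conj_mx b (repr B))) => [|A /andP[RA /eqP <-]].
    rewrite sumr_const scaler_nat; congr (_ *+ _).
    rewrite -[#|H : Q|](card_imset _ (act_inj 'Rs (repr B))); apply: eq_card => A.
    rewrite [in LHS]/in_mem /=; apply/andP/imsetP.
      case=> RA /eqP; have [GA defA] := rcosets_repr sQG RA; move=> HAB.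
      have /rcosetP[h Hh Ah] : repr A \in H :* repr B by rewrite -defB -HAB rcoset_refl.
      exists (Q :* h); first by apply/rcosetsP; exists h.
      by rewrite rcosetE -rcosetM -Ah.
    case=> _ /rcosetsP[h Hh ->] ->; rewrite rcosetE -rcosetM; split.
      by apply/rcosetsP; exists (h * repr B)%g; rewrite // groupM // (subsetP sHG).
    have /rcosetP[q Qq ->] := mem_repr_rcoset Q (h * repr B).
    rewrite mulgA [in X in _ == X]defB !rcosetM. 
    by rewrite (rcoset_id (subsetP sQH q Qq)) rcoset_id.
  have [GA defA] := rcosets_repr sQG RA.
  by rewrite (conj_mx_repr sHG).
move=> A RA; have [GA _] := rcosets_repr sQG RA.
by apply/rcosetsP; exists (repr A).
Qed.

Lemma rel_trace_mulr (H : {group gT}) b X : H \subset G ->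
  intertwines r r X -> rel_trace r H b *m X = rel_trace r H (b *m X).
Proof.
move=> sHG hX; rewrite mulmx_suml; apply: eq_bigr => i _.
by rewrite -!mulmxA hX // coset_rep_in.
Qed.

(** Transports traces from a summand to the ambient module: if the identity of the summand is a
    trace from [H], so is the idempotent that cuts it out. *)
Lemma rel_trace_conj (H : {group gT}) m (rU : mx_representation F G m)
    (f : 'M_(m, n)) (g : 'M_(n, m)) b :
  H \subset G -> intertwines rU r f -> intertwines r rU g ->
  commutes_on rU H b ->
  commutes_on r H (g *m b *m f) /\
  g *m rel_trace rU H b *m f = rel_trace r H (g *m b *m f).
Proof.
move=> sHG f_int g_int hb; split.
  move=> h Hh; have Gh := subsetP sHG h Hh.
  by rewrite !mulmxA g_int // -[g *m _ *m b]mulmxA hb // -!mulmxA f_int.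
rewrite mulmx_sumr mulmx_suml; apply: eq_bigr => i _.
have Gi := coset_rep_in sHG i.
by rewrite !mulmxA g_int ?groupV // -!mulmxA f_int.
Qed.

End RelativeTrace.

(** * A criterion for a summand with given vertex *)

(** Fitting's lemma. The characteristic polynomial is X^k q with q prime to X. If u X^(k+1) + v q =
    1, then e = u(a) a^(k+1) is idempotent and a^k e = a^k, by Cayley-Hamilton; so a is nilpotent
    when e is 0. *)
Lemma fitting_idempotent (F : fieldType) n (a : 'M[F]_n) :
  exists (e u : 'M_n) (k : nat),
    [/\ e = a *m u, e *m e = e,
        forall X : 'M_n, X *m a = a *m X -> X *m e = e *m X /\ X *m u = u *m X
      & iter k (mulmxr a) 1%:M *m e = iter k (mulmxr a) 1%:M].
Proof.
case: n a => [|n] a.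
  have eq0 (X Y : 'M[F]_0) : X = Y by rewrite (thinmx0 X) (thinmx0 Y).
  by exists 0, 0, 0%N; split=> [||X _|]; try split; apply: eq0.
pose chi := char_poly a.
have chi0 : chi != 0 by rewrite monic_neq0 ?char_poly_monic.
have [k [q nq0 chiE]] := multiplicity_XsubC chi 0.
rewrite subr0 chi0 /= in nq0 chiE.
(* The exponent is k+1 rather than k so that [e] keeps a factor [a] even when k = 0. *)
have cop : coprimep ('X ^+ k.+1) q by rewrite coprimep_expl // coprimep_sym coprimepX.
have /Bezout_eq1_coprimepP[[u v] /= uv] := cop.
have Hchi : horner_mx a (q * 'X^k) = 0 by rewrite -chiE Cayley_Hamilton.
have vqE : v * q = 1 - u * 'X^(k.+1) by rewrite -uv addrC addKr.
have vq1 : horner_mx a (v * q) = 1 - horner_mx a (u * 'X^(k.+1)).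
  by rewrite vqE rmorphB rmorph1.
exists (horner_mx a (u * 'X^(k.+1))), (horner_mx a (u * 'X^k)), k; split.
- have -> : u * 'X^(k.+1) = 'X * (u * 'X^k) by rewrite exprS mulrCA.
  by rewrite rmorphM /= horner_mx_X.
- apply/eqP; rewrite -subr_eq0 -opprB oppr_eq0 -[X in X - _]mulmx1 -mulmxBr.
  rewrite -[1%:M]/1 -vq1 -[_ *m _]rmorphM /=.
  have -> : u * 'X^(k.+1) * (v * q) = u * 'X * v * (q * 'X^k).
    by rewrite exprS; ring.
  by rewrite rmorphM /= Hchi mulr0.
- by move=> X cXa; split; apply: comm_mx_horner.
have -> : iter k (mulmxr a) 1%:M = horner_mx a 'X^k.
  elim: k {nq0 chiE cop uv Hchi vqE vq1} => [|k IHk]; first by rewrite expr0 [RHS]rmorph1.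
  by rewrite iterS IHk exprSr rmorphM /= horner_mx_X.
apply/eqP; rewrite -subr_eq0 -opprB oppr_eq0 -[X in X - _]mulmx1 -mulmxBr.
rewrite -[1%:M]/1 -vq1 -[_ *m _]rmorphM /=.
have -> : 'X^k * (v * q) = v * (q * 'X^k) by rewrite mulrC mulrA.
by rewrite rmorphM /= Hchi mulr0.
Qed.

(** [P] is an arbitrary proposition, so the descent on [f] decides by excluded middle whether a
    smaller value occurs. *)
Lemma exists_minimizer (T : Type) (P : T -> Prop) (f : T -> nat) :
  (exists x, P x) -> exists2 x, P x & forall y, P y -> (f x <= f y)%N.
Proof.
case=> x0; have [k] := ubnP (f x0); elim: k x0 => // k IHk x fx Px.
case: (classic (exists2 y, P y & (f y < f x)%N)) => [[y Py fyx]|nex].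
  by apply: (IHk y) => //; apply: leq_trans fyx _.
by exists x => // y Py; rewrite leqNgt; apply/negP => lt; case: nex; exists y.
Qed.

Section VertexCriterion.

Variables (F : fieldType) (gT : finGroupType) (G Q : {group gT}) (n : nat).
Variables (r : mx_representation F G n) (P a b : 'M[F]_n) (v : 'rV[F]_n) (c : F).
Hypothesis sQG : Q \subset G.

(* X |-> P *m X *m P plays the role of the Brauer morphism. *)
Hypothesis P_mul : forall X Y, intertwines r r X -> intertwines r r Y ->
  P *m (X *m Y) *m P = P *m X *m P *m Y *m P.
Hypothesis P_trace : forall (R : {group gT}) d, R \proper Q ->
  commutes_on r R d -> P *m rel_trace r R d *m P = 0.
Hypothesis b_comm : commutes_on r Q b.
Hypothesis a_def : a = rel_trace r Q b.
Hypothesis v_fix : v *m P = v.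
Hypothesis v_eigen : v *m a *m P = c *: v.
Hypotheses (v_neq0 : v != 0) (c_neq0 : c != 0).

(** Idempotents that are traces from [Q] and survive the Brauer morphism; one of least rank will cut
    out the summand. *)
Let vertex_idem (e : 'M_n) := [/\ intertwines r r e, e *m e = e,
  exists2 d, commutes_on r Q d & rel_trace r Q d = e & P *m e *m P != 0].

Let vertex_idem_ex : exists e, vertex_idem e.
Proof.
have a_int : intertwines r r a by rewrite a_def; apply: rel_trace_commutes.
have [e [u [k [eau ee comm_e ake]]]] := fitting_idempotent a.
have e_int : intertwines r r e by move=> x Gx; have [] := comm_e _ (a_int x Gx).
have u_int : intertwines r r u by move=> x Gx; have [] := comm_e _ (a_int x Gx).
exists e; split=> //.
  exists (b *m u); last by rewrite -rel_trace_mulr // -a_def eau.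
  move=> h Qh; have Gh := subsetP sQG h Qh.
  by rewrite mulmxA b_comm // -!mulmxA u_int.
(* P e P = 0 would give P a^k P = P a^k e P = 0, whereas [v] shows that P a^k P has the non-zero
   eigenvalue [c ^+ k]. *)
apply/eqP=> PeP0; pose ak j := iter j (mulmxr a) (1%:M : 'M[F]_n).
have ak_int j : intertwines r r (ak j).
  elim: j => [|j IHj] x Gx; first by rewrite mulmx1 mul1mx.
  by rewrite /ak iterS /= mulmxA IHj // -!mulmxA a_int.
have vak j : v *m ak j *m P = c ^+ j *: v.
  elim: j => [|j IHj]; first by rewrite mulmx1 v_fix scale1r.
  have -> : v *m ak j.+1 *m P = v *m (P *m (ak j *m a) *m P).
    by rewrite /ak iterS /= !mulmxA v_fix.
  rewrite P_mul // !mulmxA v_fix IHj -!scalemxAl v_eigen scalerA exprSr.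
  by [].
have : v *m ak k *m P = 0.
  rewrite /ak -ake -{1}v_fix -[v *m P *m _]mulmxA -(mulmxA v) mulmxA.
  have -> : v *m (P *m (ak k *m e)) *m P = v *m (P *m (ak k *m e) *m P).
    by rewrite !mulmxA.
  rewrite P_mul // -[P *m ak k *m P *m e *m P]mulmxA -(mulmxA _ P) (mulmxA P e) PeP0.
  by rewrite !mulmx0.
by move/eqP; rewrite vak scaler_eq0 expf_eq0 (negPf c_neq0) andbF (negPf v_neq0).
Qed.

Let split_idem (e : 'M_n) (e_int : intertwines r r e) (ee : e *m e = e)
    (modU : mxmodule r e) :
  exists (f : 'M_(\rank e, n)) (g : 'M_(n, \rank e)),
    [/\ intertwines (submod_repr modU) r f, intertwines r (submod_repr modU) g,
       g *m f = e & f *m g = 1%:M].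
Proof.
exists (@val_submod _ _ e _ 1%:M), (in_submod e e).
have fe : @val_submod _ _ e _ 1%:M *m e = @val_submod _ _ e _ 1%:M.
  have /submxP[w ->] : (@val_submod _ _ e _ 1%:M <= e)%MS by apply: val_submodP.
  by rewrite -mulmxA ee.
split; first exact: intertwines_val.
- exact: intertwines_in.
- by rewrite -val_submodE in_submodK.
by rewrite in_submodE mulmxA fe -in_submodE val_submodK.
Qed.

(** The image of a [vertex_idem] e of least rank works. If it splits, one of the two projections
    survives the Brauer morphism and, being again a trace from [Q], has full rank by minimality. If
    it is projective relative to a proper subgroup of [Q], then e is a trace from that subgroup and
    [P_trace] kills it. *)
Theorem summand_with_vertex : exists (U : 'M[F]_n) (modU : mxmodule r U),
  [/\ direct_summand r U, indecomposable (submod_repr modU)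
    & is_vertex (submod_repr modU) Q].
Proof.
have [e [e_int ee [d d_comm d_tr] PeP] e_min] :=
  exists_minimizer (fun e : 'M_n => \rank e) vertex_idem_ex.
have modU := intertwines_mxmodule e_int.
exists e, modU; split; first exact: idem_direct_summand.
  split; first by rewrite lt0n mxrank_eq0; apply: contraNneq PeP => ->; rewrite mulmx0 mul0mx.
  have [f [g [f_int g_int gf fg]]] := split_idem e_int ee modU.
  move: (submod_repr modU) f_int g_int => rU f_int g_int U1 V1 modU1 modV1 defU dxU.
  have dx0 : (U1 :&: V1 = 0)%MS by apply/mxdirect_addsP.
  have dx0' : (V1 :&: U1 = 0)%MS by rewrite capmxC.
  have rkU : (\rank U1 + \rank V1 = \rank e)%N.
    by move/mxdirectP: dxU => /= <-; rewrite defU mxrank1.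
  (* The projection onto [X], viewed on the ambient module, again satisfies [vertex_idem]:
     multiplying [d] by it exhibits it as a trace. *)
  have comp_full X Y : mxmodule rU X -> mxmodule rU Y -> (X + Y :=: 1%:M)%MS ->
      (X :&: Y = 0)%MS -> P *m (g *m proj_mx X Y *m f) *m P != 0 ->
      (\rank e <= \rank X)%N.
    move=> modX modY defXY dxXY nz; set pi := proj_mx X Y in nz.
    have pi_int : intertwines rU rU pi.
      move=> x Gx; have := proj_mx_hom dxXY modX modY.
      by rewrite defXY => /hom_mxP/(_ x Gx); rewrite !mul1mx.
    have pi_idem : pi *m pi = pi by exact: proj_mx_proj.
    have pi_sub : (pi <= X)%MS by rewrite -[pi]mul1mx proj_mx_sub.
    move: pi nz pi_int pi_idem pi_sub => pi nz pi_int pi_idem pi_sub.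
    have pi_int' : intertwines r r (g *m pi *m f).
      exact/(intertwinesM _ f_int)/(intertwinesM g_int pi_int).
    have le_pi : (\rank (g *m pi *m f) <= \rank X)%N.
      apply: leq_trans (mxrankM_maxl _ _) _; apply: leq_trans (mxrankM_maxr _ _) _.
      exact: mxrankS.
    apply: leq_trans (e_min _ _) le_pi; split=> //.
      rewrite !mulmxA -(mulmxA _ f g) fg mulmx1 -[g *m pi *m pi]mulmxA.
      by rewrite pi_idem.
    exists (d *m (g *m pi *m f)); last first.
      rewrite -rel_trace_mulr // d_tr -[X in X *m _ = _]gf.
      by rewrite -!mulmxA (mulmxA f g) fg mul1mx.
    move=> h Qh; have Gh := subsetP sQG h Qh.
    by rewrite [LHS]mulmxA d_comm // -[LHS]mulmxA pi_int' // [LHS]mulmxA.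
  have pi1 : proj_mx U1 V1 + proj_mx V1 U1 = 1%:M.
    by rewrite -[proj_mx U1 V1]mul1mx -[proj_mx V1 U1]mul1mx add_proj_mx // defU.
  have : P *m (g *m proj_mx U1 V1 *m f) *m P + P *m (g *m proj_mx V1 U1 *m f) *m P != 0.
    by rewrite -mulmxDl -mulmxDr -mulmxDl -mulmxDr pi1 mulmx1 gf.
  have defU' : (V1 + U1 :=: 1%:M)%MS by rewrite addsmxC.
  case: (eqVneq (P *m (g *m proj_mx U1 V1 *m f) *m P) 0) => [-> | nz1 _].
    rewrite add0r => /(comp_full _ _ modV1 modU1 defU' dx0') leV; left.
    by apply/eqP; rewrite -mxrank_eq0 -(addn0 (\rank U1)); lia.
  have leU := comp_full _ _ modU1 modV1 defU dx0 nz1; right.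
  by apply/eqP; rewrite -mxrank_eq0; lia.
have [f [g [f_int g_int gf fg]]] := split_idem e_int ee modU.
split.
  by apply: (relatively_projective_of_trace sQG f_int g_int fg d_comm); rewrite gf.
move=> R sRQ projR; apply/eqP; rewrite eqEproper sRQ; apply/negP=> prRQ.
have sRG := subset_trans sRQ sQG.
have [b0 b0_comm b0_tr] := trace_of_relatively_projective sRG projR.
case/eqP: PeP; rewrite -{1}gf -[g]mulmx1 -b0_tr.
have [gbf_comm ->] := rel_trace_conj sRG f_int g_int b0_comm.
exact: P_trace.
Qed.

End VertexCriterion.

(** * Permutation modules *)

Section FixedPoints.

Variables (F : fieldType) (p : nat).
Hypothesis F_char : p \in [pchar F].

(** [E] is constant on orbits, and an orbit with more than one point has length a positive power of
    p, hence contributes 0 in [F]. *)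
Lemma sum_pgroup_fix (gT : finGroupType) (X : finType) (Q : {group gT})
    (to : {action gT &-> X}) (D : {set X}) (E : X -> F) :
  p.-group Q -> [acts Q, on D | to] ->
  (forall x g, g \in Q -> x \in D -> E (to x g) = E x) ->
  \sum_(x in D) E x = \sum_(x in D | x \in 'Fix_to(Q)) E x.
Proof.
move=> pQ actQ invE; have partD := orbit_partition actQ.
rewrite (set_partition_big _ partD) (set_partition_big_cond _ partD) /=.
apply: eq_bigr => _ /imsetP[x Dx ->].
have orbD y : y \in orbit to Q x -> y \in D.
  by apply: subsetP; rewrite acts_sub_orbit.
have Eorb y : y \in orbit to Q x -> E y = E x.
  by case/orbitP=> g Qg <-; apply: invE.
case: (boolP (x \in 'Fix_to(Q))) => [fx | nfx].
  apply: eq_bigl => y; case: (boolP (y \in orbit to Q x)) => //=.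
  by rewrite (orbit1P fx) inE => /eqP->; rewrite fx.
rewrite [RHS]big1 => [|y /andP[yx fy]]; last first.
  have xy : x \in orbit to Q y by rewrite orbit_sym.
  by move: xy; rewrite (orbit1P fy) inE => /eqP xy; rewrite xy fy in nfx.
rewrite (eq_bigr (fun=> E x)) // sumr_const -mulr_natr.
have /p_natP[[|k] cardO] : p.-nat #|orbit to Q x|.
- by rewrite card_orbit; apply: pnat_dvd pQ; apply: dvdn_indexg.
- have /cards1P[y orby] : #|orbit to Q x| == 1%N by rewrite cardO.
  case/orbit1P: nfx; have := orbit_refl to Q x.
  by rewrite orby inE => /eqP->.
by rewrite cardO expnS natrM (pcharf0 F_char) mul0r mulr0.
Qed.

Lemma sum_perm_fix (X : finType) (s : {perm X}) (D : {set X}) (E : X -> F) :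
  (s ^+ p = 1)%g -> (forall x, x \in D -> s x \in D) ->
  (forall x, x \in D -> E (s x) = E x) ->
  \sum_(x in D) E x = \sum_(x in D | s x == x) E x.
Proof.
move=> sp sD sE.
have pr_p : prime p by have /andP[] := F_char.
have sDn i x : x \in D -> (s ^+ i)%g x \in D /\ E ((s ^+ i)%g x) = E x.
  move=> Dx; elim: i => [|i [IHD IHE]]; first by rewrite perm1.
  by rewrite expgSr permM sE ?sD.
rewrite (@sum_pgroup_fix _ _ <[s]> 'P).
- apply: eq_bigl => x; case: (boolP (x \in D)) => //= _.
  by rewrite afix_cycle; apply/afix1P/eqP; rewrite /= apermE.
- rewrite /pgroup -orderE; apply: (@pnat_dvd _ p); first by rewrite order_dvdn sp.
  exact: pnat_id.
- apply/subsetP=> _ /cycleP[i ->]; rewrite !inE /=; apply/subsetP=> x Dx.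
  by rewrite inE /= apermE; case: (sDn i x Dx).
by move=> x _ /cycleP[i ->] Dx; rewrite /= apermE; case: (sDn i x Dx).
Qed.

Lemma sum_iter_fix (X : finType) (f : X -> X) (D : {set X}) (E : X -> F) :
  (forall x, iter p f x = x) -> (forall x, x \in D -> f x \in D) ->
  (forall x, x \in D -> E (f x) = E x) ->
  \sum_(x in D) E x = \sum_(x in D | f x == x) E x.
Proof.
move=> fp fD fE; have p_gt0 : (0 < p)%N by case/andP: F_char => /prime_gt0.
have f_inj : injective f.
  move=> x y fxy; rewrite -(fp x) -(fp y) -(prednK p_gt0) !iterSr fxy.
  by [].
rewrite (@sum_perm_fix _ (perm f_inj)) => [|||x Dx]; rewrite ?permE ?fE //.
- by apply: eq_bigl => x; rewrite permE.
- apply/permP=> x; rewrite permX perm1 -[RHS]fp.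
  by elim: (p) => //= k ->; rewrite permE.
by move=> x Dx; rewrite permE fD.
Qed.

End FixedPoints.

(** * The Brauer morphism of a permutation module *)

Section PermutationModule.

Variables (F : fieldType) (p : nat).
Hypothesis F_char : p \in [pchar F].
Variables (gT : finGroupType) (T : finType) (G : {group gT}).
Variables (to : {action gT &-> T}) (S : {set T}).
Hypothesis actsGS : [acts G, on S | to].

Let r := perm_repr F actsGS.
Let I := 'I_#|S|.

Let rk (i : I) x : I := enum_rank_in (enum_valP i) x.
Let aidx (g : gT) (i : I) : I := rk i (to (enum_val i) g).

Let rkK i x : x \in S -> enum_val (rk i x) = x.
Proof. exact: enum_rankK_in. Qed.

Let rk_val i k : rk i (enum_val k) = k.
Proof. exact: enum_valK_in. Qed.

Let val_aidx g i : g \in G -> enum_val (aidx g i) = to (enum_val i) g.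
Proof. by move=> Gg; rewrite rkK // (acts_act actsGS) // enum_valP. Qed.

Let mulrE (g : gT) m (X : 'M_(#|S|, m)) i j : g \in G -> (r g *m X) i j = X (aidx g i) j.
Proof.
move=> Gg; rewrite !mxE (bigD1 (aidx g i)) //= big1 => [|k nk]; rewrite !mxE.
  by rewrite val_aidx // eqxx mul1r addr0.
by rewrite -val_aidx // (inj_eq enum_val_inj) eq_sym (negPf nk) mul0r.
Qed.

Let mulErV (g : gT) m (X : 'M_(m, #|S|)) i j : g \in G -> (X *m r g^-1%g) i j = X i (aidx g j).
Proof.
move=> Gg; rewrite !mxE (bigD1 (aidx g j)) //= big1 => [|k nk]; rewrite !mxE.
  by rewrite val_aidx // actK eqxx mulr1 addr0.
case: eqP => [e|_]; last by rewrite mulr0.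
case/eqP: nk; apply: enum_val_inj; by rewrite val_aidx // -e actKV.
Qed.

Let conjE (g : gT) (X : 'M_#|S|) i j : g \in G ->
  conj_mx r X g i j = X (aidx g^-1 i) (aidx g^-1 j).
Proof.
move=> Gg; rewrite /conj_mx -{2}[g]invgK mulErV ?groupV //.
by rewrite mulrE ?groupV.
Qed.

Variable Q : {group gT}.
Hypotheses (sQG : Q \subset G) (pQ : p.-group Q).

(** Multiplying an endomorphism by this on both sides restricts it to the [Q]-fixed points: the
    Brauer morphism in matrix form. *)
Definition fixed_mx : 'M[F]_#|S| :=
  \matrix_(i, j) ((i == j) && (enum_val i \in 'Fix_to(Q)))%:R.

Local Notation P := fixed_mx.

Let PXE m (X : 'M_(_, m)) i j : (P *m X) i j = (enum_val i \in 'Fix_to(Q))%:R * X i j.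
Proof.
rewrite mxE (bigD1 i) //= big1 => [|k nk]; rewrite !mxE ?eqxx ?addr0 //.
by rewrite eq_sym (negPf nk) mul0r.
Qed.

Let XPE m (X : 'M_(m, _)) i j : (X *m P) i j = X i j * (enum_val j \in 'Fix_to(Q))%:R.
Proof.
rewrite mxE (bigD1 j) //= big1 => [|k nk]; rewrite !mxE ?eqxx ?addr0 //.
by rewrite (negPf nk) mulr0.
Qed.

Let aidx_fix q i : q \in Q -> enum_val i \in 'Fix_to(Q) -> aidx q i = i.
Proof.
move=> Qq /afixP/(_ q Qq) fi; apply: enum_val_inj.
by rewrite val_aidx ?(subsetP sQG).
Qed.

Let intertwinesE (X : 'M_#|S|) : intertwines r r X ->
  forall g i j, g \in G -> X (aidx g i) (aidx g j) = X i j.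
Proof.
move=> hX g i j Gg; rewrite -mulErV // -mulrE // mulmxA hX // -mulmxA.
by rewrite -(@repr_mxM _ _ _ _ r) ?groupV // mulgV repr_mx1 mulmx1.
Qed.

(** For fixed indices i and j, the summand X i x Y x j of the product is constant on the [Q]-orbits
    of x, so modulo p only the fixed x count. *)
Lemma fixed_mx_mul X Y : intertwines r r X -> intertwines r r Y ->
  P *m (X *m Y) *m P = P *m X *m P *m Y *m P.
Proof.
move=> hX hY; apply/matrixP=> i j.
rewrite XPE PXE [in RHS]XPE -!mulmxA PXE; case: (boolP (_ i \in _)) => fi; last first.
  by rewrite !mul0r.
case: (boolP (_ j \in _)) => fj; last by rewrite !mulr0.
rewrite !mul1r !mulr1 2!mxE.
pose E x := X i (rk i x) * Y (rk i x) j.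
transitivity (\sum_(x in S) E x).
  by rewrite [RHS]big_enum_val; apply: eq_bigr => k _; rewrite /E rk_val.
have actQ : [acts Q, on S | to] := subset_trans sQG actsGS.
rewrite (sum_pgroup_fix F_char pQ actQ) => [|x q Qq Sx].
  rewrite big_mkcondr big_enum_val. apply: eq_bigr => k _.
  by rewrite /E rk_val PXE; case: ifP => _; rewrite ?mul1r // mul0r mulr0.
have Gq := subsetP sQG q Qq.
have rkq : rk i (to x q) = aidx q (rk i x).
  apply: enum_val_inj; rewrite val_aidx // !rkK //.
  by rewrite (acts_act actsGS).
rewrite /E rkq; move: (rk i x) => k; congr (_ * _).
  by rewrite -[in LHS](aidx_fix Qq fi) intertwinesE.
by rewrite -[in LHS](aidx_fix Qq fj) intertwinesE.
Qed.

Lemma rel_trace_fixed (H : {group gT}) d i j : H \subset G -> commutes_on r H d ->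
  enum_val i \in 'Fix_to(Q) -> enum_val j \in 'Fix_to(Q) ->
  rel_trace r H d i j = \sum_(A in rcosets H G | A \in 'Fix_('Rs)(Q)) 
     conj_mx r d (repr A) i j.
Proof.
move=> sHG hd fi fj; rewrite rel_traceE summxE.
have actQ : [acts Q, on rcosets H G | 'Rs].
  exact: subset_trans sQG (actsRs_rcosets H G).
rewrite (sum_pgroup_fix F_char pQ actQ) // => A q Qq RA.
have Gq := subsetP sQG q Qq; have [GA defA] := rcosets_repr sHG RA.
have -> : 'Rs%act A q = H :* (repr A * q) by rewrite [LHS]rcosetE rcosetM -defA.
rewrite (conj_mx_repr sHG hd) ?groupM // !conjE ?groupM //.
have fixV k : enum_val k \in 'Fix_to(Q) ->
    aidx (repr A * q)^-1 k = aidx (repr A)^-1 k.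
  move=> /afixP/(_ q^-1%g (groupVr Qq)) fk.
  by apply: enum_val_inj; rewrite !val_aidx ?groupV ?groupM // invMg actM fk.
by rewrite !fixV.
Qed.

(** A coset R g fixed by [Q] would put g Q g^-1 inside [R], which is impossible by cardinality; so
    the sum over fixed cosets is empty. *)
Lemma fixed_mx_trace (R : {group gT}) d : R \proper Q ->
  commutes_on r R d -> P *m rel_trace r R d *m P = 0.
Proof.
move=> prRQ hd; have sRG := subset_trans (proper_sub prRQ) sQG.
apply/matrixP=> i j; rewrite XPE PXE mxE.
case: (boolP (_ i \in _)) => fi; last by rewrite !mul0r.
case: (boolP (_ j \in _)) => fj; last by rewrite !mulr0.
rewrite (rel_trace_fixed sRG hd fi fj) big_pred0 ?mulr0 ?mul0r // => A.
apply/andP=> -[RA /afixP fA]; have [GA defA] := rcosets_repr sRG RA.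
have : (Q :^ (repr A)^-1 \subset R).
  apply/subsetP=> _ /imsetP[q Qq ->].
  have rA : repr A \in A by rewrite {2}defA rcoset_refl.
  have : (repr A * q)%g \in 'Rs%act A q by rewrite /= rcosetE mem_rcoset mulgK.
  by rewrite fA // conjgE invgK mulgA -mem_rcoset -defA.
move/subset_leq_card; rewrite cardJg leqNgt => /negP; apply.
exact: proper_card.
Qed.

(** The criterion is applied to the trace of [b] from [H]. Between fixed points only the [Q]-fixed
    cosets contribute to it, so the condition on [w] says that [w] is an eigenvector of its Brauer
    image. *)
Theorem perm_summand_with_vertex (H : {group gT}) (b : T -> T -> F)
    (w : T -> F) (c : F) :
  Q \subset H -> H \subset G -> ~~ (p %| #|H : Q|)%N ->
  (forall h x y, h \in H -> x \in S -> y \in S -> b (to x h) (to y h) = b x y) ->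
  (forall x, x \in S -> x \notin 'Fix_to(Q) -> w x = 0) ->
  (forall y, y \in S -> y \in 'Fix_to(Q) ->
     \sum_(x in S) w x * \sum_(A in rcosets H G | A \in 'Fix_('Rs)(Q)) 
       b (to x (repr A)^-1%g) (to y (repr A)^-1%g) = c * w y) ->
  c != 0 -> (exists2 x, x \in S & w x != 0) ->
  exists (U : 'M[F]_#|S|) (modU : mxmodule r U),
  [/\ direct_summand r U, indecomposable (submod_repr modU)
    & is_vertex (submod_repr modU) Q].
Proof.
move=> sQH sHG p'HQ bH w0 wE nc [x0 Sx0 wx0].
pose B : 'M[F]_#|S| := \matrix_(i, j) b (enum_val i) (enum_val j).
have B_comm : commutes_on r H B.
  move=> h Hh; have Gh := subsetP sHG h Hh; apply/matrixP=> i j.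
  rewrite mulrE // -[h in RHS]invgK mulErV ?groupV // !mxE !val_aidx ?groupV //.
  rewrite -(bH h _ _ Hh (enum_valP i)) ?actKV // (acts_act actsGS) ?groupV //.
  exact: enum_valP.
pose v : 'rV[F]_#|S| := \row_i w (enum_val i).
(* The index is invertible in [F], so the trace of [B] from [H] is the trace from [Q] of [B] divided
   by the index. *)
have nHQ : #|H : Q|%:R != 0 :> F by rewrite -(dvdn_pcharf F_char).
have BQ_comm : commutes_on r Q (#|H : Q|%:R^-1 *: B).
  by move=> q Qq; rewrite -scalemxAr -scalemxAl B_comm ?(subsetP sQH).
apply: (@summand_with_vertex F gT G Q _ r P (rel_trace r H B) _ v c sQG
          fixed_mx_mul fixed_mx_trace BQ_comm) => //.
- have /(rel_trace_trans sQH sHG)-> : commutes_on r H (#|H : Q|%:R^-1 *: B).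
    by move=> h Hh; rewrite -scalemxAr -scalemxAl B_comm.
  rewrite scaler_sumr; apply: eq_bigr => i _.
  by rewrite -scalemxAr -scalemxAl scalerA divff // scale1r.
- apply/rowP=> i; rewrite XPE !mxE; case: (boolP (_ \in _)) => fi; rewrite ?mulr1 //.
  by rewrite mulr0 w0 // enum_valP.
- apply/rowP=> j; rewrite XPE !mxE; case: (boolP (_ \in _)) => fj; last first.
    by rewrite mulr0 (w0 (enum_val j)) ?mulr0 // enum_valP.
  rewrite mulr1 -wE ?enum_valP // [RHS]big_enum_val; apply: eq_bigr => i _.
  rewrite !mxE; case: (boolP (enum_val i \in 'Fix_to(Q))) => fi; last first.
    by rewrite w0 ?enum_valP // !mul0r.
  rewrite (rel_trace_fixed sHG B_comm fi fj); congr (_ * _).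
  apply: eq_bigr => A /andP[RA _]; have [GA _] := rcosets_repr sHG RA.
  by rewrite conjE // mxE !val_aidx ?groupV.
apply/eqP=> /rowP/(_ (enum_rank_in Sx0 x0)); rewrite !mxE enum_rankK_in //.
by apply/eqP.
Qed.

End PermutationModule.

(** * Matchings and words *)

Section Matchings.

Variable T : finType.
Implicit Types (A Z : {set T}) (P S : {set {set T}}).

(** Taken on an arbitrary subset so that the standard pairs can be split off; on the whole set this
    is convertible to [pair_partitions]. *)
Definition matchings A : {set {set {set T}}} :=
  [set P : {set {set T}} | partition P A & [forall B in P, #|B| == 2%N]].

Lemma matchingsP A P :
  reflect [/\ cover P = A, trivIset P & forall B, B \in P -> #|B| = 2%N]
          (P \in matchings A).
Proof.
rewrite inE; apply: (iffP andP) => [[/and3P[/eqP cP tP _] /forall_inP P2]|[cP tP P2]].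
  by split=> // B /P2/eqP.
split; last by apply/forall_inP=> B /P2/eqP.
apply/and3P; split=> //; first exact/eqP.
by apply/negP=> /P2; rewrite cards0.
Qed.

Lemma matchings_block A P B C x :
  P \in matchings A -> B \in P -> C \in P -> x \in B -> x \in C -> B = C.
Proof.
case/matchingsP=> _ tP _ PB PC Bx Cx; apply/eqP.
apply: contraTT Bx => nBC; apply: contraL Cx => Bx.
by have /pred0P/(_ x) /= := trivIsetP tP _ _ PB PC nBC; rewrite Bx => /negbT.
Qed.

Lemma matchings_sub A P B : P \in matchings A -> B \in P -> B \subset A.
Proof. by case/matchingsP=> <- _ _ PB; apply: bigcup_sup. Qed.

Lemma matchings_partner A P x : P \in matchings A -> x \in A ->
  exists y, [/\ y \in A, y != x & [set x; y] \in P].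
Proof.
move=> MP Ax; have /matchingsP[cP _ P2] := MP.
have /bigcupP[B PB Bx] : x \in cover P by rewrite cP.
have /eqP/cards2P[a [b [nab defB]]] := P2 B PB.
move: Bx; rewrite defB !inE => /orP[] /eqP xE; rewrite {}xE.
  exists b; rewrite eq_sym nab -defB; split=> //.
  by rewrite (subsetP (matchings_sub MP PB)) // defB !inE eqxx orbT.
exists a; rewrite nab setUC -defB; split=> //.
by rewrite (subsetP (matchings_sub MP PB)) // defB !inE eqxx.
Qed.

Lemma matchingsU A Z P S : [disjoint Z & A] ->
  S \in matchings Z -> P \in matchings A -> S :|: P \in matchings (Z :|: A).
Proof.
move=> dZA MS MP; have /matchingsP[cS tS S2] := MS.
have [cP tP P2] := matchingsP _ _ MP; apply/matchingsP; split.
- by rewrite /cover bigcup_setU -/(cover _) -/(cover _) cS cP.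
- have dSP B C : B \in S -> C \in P -> [disjoint B & C].
    move=> SB PC; apply: disjointWl (matchings_sub MS SB) _.
    exact: disjointWr (matchings_sub MP PC) dZA.
  apply/trivIsetP=> B C; rewrite !inE.
  case/orP=> hB /orP[] hC nBC; try by apply: dSP.
  + exact: (trivIsetP tS).
  + by rewrite disjoint_sym dSP.
  exact: (trivIsetP tP).
by move=> B; rewrite inE => /orP[/S2|/P2].
Qed.

Lemma matchingsD A Z P S : S \in matchings Z -> P \in matchings A ->
  S \subset P -> P :\: S \in matchings (A :\: Z).
Proof.
move=> MS MP sSP; have /matchingsP[cS tS S2] := MS.
have [cP tP P2] := matchingsP _ _ MP; apply/matchingsP; split.
- apply/setP=> x; rewrite -cS -cP inE; apply/bigcupP/andP.
    case=> B /setDP[PB nSB] Bx; split; last by apply/bigcupP; exists B.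
    apply: contra nSB => /bigcupP[C SC Cx].
    by rewrite (matchings_block MP PB (subsetP sSP _ SC) Bx Cx).
  case=> nSx /bigcupP[B PB Bx]; exists B => //; rewrite inE PB andbT.
  by apply: contra nSx => SB; apply/bigcupP; exists B.
- exact: trivIsetS (subsetDl _ _) tP.
by move=> B /setDP[/P2].
Qed.

Lemma matchings_disjoint A Z P S : [disjoint Z & A] ->
  S \in matchings Z -> P \in matchings A -> [disjoint S & P].
Proof.
move=> dZA MS MP; apply/pred0P=> B /=; apply/negP=> /andP[SB PB].
have /matchingsP[_ _ /(_ _ SB) B2] := MS.
have /card_gt0P[x Bx] : (0 < #|B|)%N by rewrite B2.
have := pred0P dZA x; rewrite /= (subsetP (matchings_sub MS SB)) //.
by rewrite (subsetP (matchings_sub MP PB)).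
Qed.

Lemma matchings_pair x y : x != y -> [set [set x; y]] \in matchings [set x; y].
Proof.
move=> nxy; apply/matchingsP; split.
- by rewrite /cover big_set1.
- apply/trivIsetP=> B C; rewrite !inE => /eqP-> /eqP->; by rewrite eqxx.
by move=> B; rewrite inE => /eqP->; rewrite cards2 nxy.
Qed.

Definition compatible (X : eqType) (u : T -> X) P :=
  [forall B in P, forall x in B, forall y in B, u x == u y].

Lemma compatibleP (X : eqType) (u : T -> X) P :
  reflect (forall B x y, B \in P -> x \in B -> y \in B -> u x = u y)
          (compatible u P).
Proof.
apply: (iffP forall_inP) => [h B x y PB Bx By|h B PB].
  by have /forall_inP/(_ x Bx)/forall_inP/(_ y By)/eqP := h B PB.
by apply/forall_inP=> x Bx; apply/forall_inP=> y By; rewrite (h B x y).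
Qed.

Lemma compatible_set2U (X : eqType) (u : T -> X) P x y :
  compatible u ([set x; y] |: P) = (u x == u y) && compatible u P.
Proof.
apply/compatibleP/andP=> [h|[/eqP xy /compatibleP h] B a b].
  split; first by rewrite (h [set x; y] x y) ?setU11 ?set21 ?set22.
  by apply/compatibleP=> B a b PB; apply: (h B); rewrite setU1r.
case/setU1P=> [->|PB]; last exact: (h B).
by rewrite !inE => /orP[]/eqP-> /orP[]/eqP->.
Qed.

Lemma compatible_pair (X Y : eqType) (u : T -> X) (w : T -> Y) P :
  compatible (fun x => (u x, w x)) P = compatible u P && compatible w P.
Proof.
apply/compatibleP/andP=> [h|[/compatibleP hu /compatibleP hw] B x y PB Bx By].
  by split; apply/compatibleP=> B x y PB Bx By; have [] := h B x y PB Bx By.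
by rewrite (hu B x y) ?(hw B x y).
Qed.

Definition nb_matchings (X : eqType) (u : T -> X) A :=
  #|[set P in matchings A | compatible u P]|.

Lemma nb_matchings0 (X : eqType) (u : T -> X) : nb_matchings u set0 = 1%N.
Proof.
rewrite /nb_matchings (_ : [set _ in _ | _] = [set set0]) ?cards1 //.
apply/setP=> P; rewrite in_set in_set1; apply/andP/eqP=> [[]|->].
  by rewrite inE partition_set0 => /andP[/eqP].
split; last by apply/compatibleP=> B x y; rewrite inE.
by apply/matchingsP; split=> [|| B]; rewrite ?inE // /cover ?big_set0 //; apply/trivIsetP=> B C; rewrite inE.
Qed.

(** Sorts the matchings by the partner y of x, which must carry the same letter. Gaussian moments
    obey the same recursion. *)
Lemma nb_matchings_rec (X : eqType) (u : T -> X) A x : x \in A ->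
  nb_matchings u A
  = (\sum_(y in A :\ x | u y == u x) nb_matchings u (A :\: [set x; y]))%N.
Proof.
move=> Ax; rewrite /nb_matchings -sum1_card.
(* The partner of [x] in [P]; the default [x] is never taken on a matching of [A]. *)
pose prt P := odflt x [pick y | (y != x) && ([set x; y] \in P)].
have prtP P : P \in matchings A -> prt P != x /\ [set x; prt P] \in P.
  move=> MP; have [y [Ay nyx Pxy]] := matchings_partner MP Ax.
  rewrite /prt; case: pickP => [z /andP[]//|/(_ y)]; by rewrite nyx Pxy.
have prtE P y : P \in matchings A -> y != x -> [set x; y] \in P -> prt P = y.
  move=> MP nyx Pxy; have [np Pp] := prtP P MP.
  have := set22 x y; rewrite (matchings_block MP Pxy Pp (set21 _ _) (set21 _ _)).
  by rewrite !inE (negPf nyx) => /eqP.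
rewrite (partition_big prt (fun y => (y \in A :\ x) && (u y == u x))) /=.
  apply: eq_bigr => y /andP[/setD1P[nyx Ay] uyx].
  have sxyA : [set x; y] \subset A by rewrite subUset !sub1set Ax.
  have Mxy := matchings_pair (x := x) (y := y); rewrite eq_sym nyx in Mxy.
  have dxy : [disjoint [set x; y] & A :\: [set x; y]].
    by rewrite -setI_eq0 setIDA setIC -setIDA setDv setI0.
  pose N := [set P in matchings (A :\: [set x; y]) | compatible u P].
  have injf : {in N &, injective (fun P => [set x; y] |: P)}.
    move=> P1 P2 /setIdP[MP1 _] /setIdP[MP2 _] e.
    have nP P' : P' \in matchings (A :\: [set x; y]) -> [set x; y] \notin P'.
      move=> MP'; apply/negP=> Pxy; have := matchings_sub MP' Pxy.
      by move/subsetP/(_ x (set21 _ _)); rewrite !inE eqxx.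
    by rewrite -(setU1K (nP _ MP1)) e setU1K // nP.
  rewrite sum1_card -[RHS](card_in_imset injf).
  apply: eq_card => P; rewrite [in LHS]/in_mem /=; apply/andP/imsetP.
    case=> /setIdP[MP uP] /eqP prtPy; have [_ Pxy] := prtP P MP.
    rewrite prtPy in Pxy; have sP : [set [set x; y]] \subset P by rewrite sub1set.
    exists (P :\ [set x; y]); last by rewrite setD1K.
    rewrite inE (matchingsD (Mxy isT) MP sP) /=.
    have : compatible u ([set x; y] |: P :\ [set x; y]) by rewrite setD1K.
    by rewrite compatible_set2U => /andP[].
  case=> P' /setIdP[MP' uP'] ->.
  have MP : [set x; y] |: P' \in matchings A.
    have := matchingsU dxy (Mxy isT) MP'.
    have eA : [set x; y] :|: A :\: [set x; y] = A by rewrite -{1}(setIidPr sxyA) setID.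
      by rewrite eA.
  have hN : [set x; y] |: P' \in [set P in matchings A | compatible u P].
    by rewrite inE MP compatible_set2U eq_sym uyx.
  split; first exact: hN.
  by apply/eqP; apply: prtE; rewrite ?setU11.
move=> P /setIdP[MP /compatibleP uP]; have [np Pp] := prtP P MP.
rewrite !inE np (subsetP (matchings_sub MP Pp)) ?set22 //=.
by apply/eqP; apply: (uP _ _ _ Pp); rewrite ?set21 ?set22.
Qed.

End Matchings.

(** * Permutations acting on matchings *)

Section MatchingAction.

Variable T : finType.
Implicit Types (A Z : {set T}) (P S : {set {set T}}) (s g : {perm T}).

Local Notation mact := ('P^*^*)%act.

Lemma mactE P s : mact P s = (fun B : {set T} => s @: B) @: P.
Proof.
by apply: eq_imset => B; apply: eq_imset => x; apply: apermE.
Qed.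

Lemma mem_mact P s (B : {set T}) : (s @: B \in mact P s) = (B \in P).
Proof. by rewrite mactE mem_imset //; apply: imset_inj; apply: perm_inj. Qed.

Lemma mact_set2 P s x y : ([set s x; s y] \in mact P s) = ([set x; y] \in P).
Proof. by rewrite -(mem_mact P s) imsetU !imset_set1. Qed.

Lemma mact_matchings A P s : P \in matchings A -> mact P s \in matchings (s @: A).
Proof.
case/matchingsP=> cP tP P2; apply/matchingsP; split; rewrite mactE.
- rewrite cover_imset -cP /cover; apply/setP=> x; apply/bigcupP/imsetP.
    case=> B PB /imsetP[y By ->]; exists y => //; by apply/bigcupP; exists B.
  case=> y /bigcupP[B PB By] ->; by exists B => //; apply: imset_f.
- apply/trivIsetP=> _ _ /imsetP[B PB ->] /imsetP[C PC ->] nBC.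
  rewrite imset_disjoint; last exact: perm_inj.
  by apply: (trivIsetP tP) => //; apply: contra nBC => /eqP->.
by move=> _ /imsetP[B PB ->]; rewrite card_imset ?P2 //; apply: perm_inj.
Qed.

Lemma perm_on_imset A s : perm_on A s -> s @: A = A.
Proof.
move=> onA; apply/eqP; rewrite eqEcard card_imset ?leqnn ?andbT; last exact: perm_inj.
by apply/subsetP=> _ /imsetP[x Ax ->]; rewrite perm_closed.
Qed.

Lemma mact_id A P s : P \in matchings A -> (forall x, x \in A -> s x = x) ->
  mact P s = P.
Proof.
move=> MP sA; rewrite mactE -[RHS]imset_id; apply: eq_in_imset => B PB.
rewrite -[RHS]imset_id; apply: eq_in_imset => x Bx.
by rewrite sA // (subsetP (matchings_sub MP PB)).
Qed.

Lemma mactU P S s : mact (P :|: S) s = mact P s :|: mact S s.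
Proof. by rewrite !mactE imsetU. Qed.

Lemma mactD P S s : mact (P :\: S) s = mact P s :\: mact S s.
Proof.
apply/setP=> B; have -> : B = s @: (s^-1%g @: B).
  rewrite -imset_comp -[LHS]imset_id; apply: eq_imset => x /=; by rewrite permKV.
by rewrite inE !mem_mact inE.
Qed.

Lemma mactS P S s : (mact P s \subset mact S s) = (P \subset S).
Proof.
rewrite !mactE; apply/idP/idP; last exact: imsetS.
move/subsetP=> sPS; apply/subsetP=> B PB.
by have := sPS _ (imset_f _ PB); rewrite mem_imset //; apply: imset_inj; apply: perm_inj.
Qed.

Lemma compatible_mact (X : eqType) (u : T -> X) P s :
  compatible u (mact P s) = compatible (u \o s) P.
Proof.
apply/compatibleP/compatibleP=> h B x y; last first.
  rewrite mactE => /imsetP[C PC ->] /imsetP[a Ca ->] /imsetP[b Cb ->].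
  exact: (h C).
by move=> PB Bx By; apply: (h (s @: B)); rewrite ?mem_mact ?imset_f.
Qed.

(* A matching fixed by both g and its cycle z through x0 would pair x0 with a point outside the
   cycle (then z moves x0 but not its partner) or inside it (then the cycle has even length). *)
Lemma mact_cycle_free A P (g z : {perm T}) p x0 :
  odd p -> (g ^+ p = 1)%g -> g x0 != x0 -> x0 \in A -> P \in matchings A ->
  mact P g = P -> (forall x, z x = if x \in porbit g x0 then g x else x) ->
  mact P z != P.
Proof.
move=> podd gp gx0 Ax0 MP Pg zE; apply/eqP=> Pz.
have [y [Ay nyx Pxy]] := matchings_partner MP Ax0.
have Ox0 : x0 \in porbit g x0 by apply: porbit_id.
case: (boolP (y \in porbit g x0)) => Oy; last first.
  have Pxy' : [set g x0; y] \in P.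
    have := mact_set2 P z x0 y; rewrite Pz Pxy !zE Ox0 (negPf Oy).
    by [].
  have := set21 (g x0) y; rewrite (matchings_block MP Pxy' Pxy (set22 _ _) (set22 _ _)).
  rewrite !inE (negPf gx0) => /eqP gy; case/negP: Oy; rewrite -gy.
  by have := mem_porbit g 1 x0; rewrite expg1.
have /porbitP[i yE] := Oy.
have Pgi : mact P (g ^+ i)%g = P.
  by elim: (i) => [|k IHk]; rewrite ?act1 // expgSr actM IHk Pg.
have Pyy : [set y; (g ^+ i)%g y] \in P.
  by have := mact_set2 P (g ^+ i)%g x0 y; rewrite Pgi Pxy -yE.
have := set22 y ((g ^+ i)%g y); rewrite (matchings_block MP Pyy Pxy (set21 _ _) (set22 _ _)).
rewrite !inE => /orP[]/eqP gy; last first.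
  by case/eqP: nyx; apply: (@perm_inj _ (g ^+ i)%g); rewrite gy -yE.
(* Here g^i exchanges x0 and y. As p is odd, g^i is the power (p+1)/2 of its own square, so it fixes
   x0 as well, forcing y = x0. *)
have g2i : ((g ^+ i) ^+ 2)%g x0 = x0 by rewrite expgS expg1 permM -yE.
case/eqP: nyx; rewrite yE.
have fixk k : (((g ^+ i) ^+ 2) ^+ k)%g x0 = x0.
  by elim: k => [|k IHk]; rewrite ?perm1 // expgSr permM IHk.
have gip : ((g ^+ i) ^+ p = 1)%g by rewrite -expgM mulnC expgM gp expg1n.
have {1}-> : (g ^+ i = ((g ^+ i) ^+ 2) ^+ p.+1./2)%g.
  by rewrite -[((g ^+ i) ^+ 2 ^+ _)%g]expgM mul2n odd_uphalfK // expgS gip mulg1.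
exact: fixk.
Qed.

End MatchingAction.

(** * The word kernel and its vanishing modulo p *)

Section Words.

Variables (T : finType) (A : {set T}) (R : nat) (nu : 'I_R.+1 -> nat).

Local Notation mact := ('P^*^*)%act.
Local Notation word := {ffun T -> 'I_R.+1}.

(** Forcing [ord0] outside [A] makes a word determined by its letters on [A], so other points do not
    affect the count. *)
Definition words : {set word} :=
  [set w : word | [forall x, (x \notin A) ==> (w x == ord0)] &
    [forall c, #|[set x in A | w x == c]| == nu c]].

Lemma wordsP (w : word) :
  reflect ((forall x, x \notin A -> w x = ord0) /\
           (forall c, #|[set x in A | w x == c]| = nu c)) (w \in words).
Proof.
rewrite inE; apply: (iffP andP) => [[/forallP w0 /forallP wnu]|[w0 wnu]].
  by split=> [x Ax|c]; apply/eqP; rewrite ?wnu // (implyP (w0 x)).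
by split; apply/forallP=> x; [apply/implyP=> Ax; rewrite w0 | rewrite wnu].
Qed.

Definition wcomp (w : word) (s : {perm T}) : word := [ffun x => w (s x)].

Lemma wcomp_words w (s : {perm T}) : perm_on A s -> w \in words -> wcomp w s \in words.
Proof.
move=> onA /wordsP[w0 wnu]; apply/wordsP; split=> [x nAx|c].
  by rewrite ffunE w0 // perm_closed.
rewrite -wnu -(card_imset _ (@perm_inj _ s)); apply: eq_card => x.
apply/imsetP/idP=> [[y] |].
  by rewrite inE ffunE => /andP[Ay wy] ->; rewrite inE perm_closed ?Ay.
rewrite inE => /andP[Ax wx]; exists (s^-1%g x); rewrite ?permKV //.
by rewrite inE ffunE permKV wx -(perm_closed _ onA) permKV Ax.
Qed.

Lemma compatible_wcomp (w : word) s P :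
  compatible (wcomp w s) P = compatible w (mact P s).
Proof.
rewrite compatible_mact; apply/compatibleP/compatibleP=> h B x y PB Bx By;
by have := h B x y PB Bx By; rewrite /= ?ffunE.
Qed.

Variables (F : fieldType) (p : nat).
Hypotheses (p_odd : odd p) (F_char : p \in [pchar F]).

Definition wcount P S : F :=
  #|[set w in words | compatible w P & compatible w S]|%:R.

(** The square of the kernel [wcount], the B of the overview. Squaring inserts a middle matching
    between two words, and it is this matching that a single cycle can move without fixed points. *)
Definition wcount2 P S : F := \sum_(M in matchings A) wcount P M * wcount M S.

Lemma wcount_mact P S s : perm_on A s ->
  wcount (mact P s) (mact S s) = wcount P S.
Proof.
move=> onA; rewrite /wcount; congr (_%:R).
have wK : cancel (wcomp^~ s) (wcomp^~ s^-1%g).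
  by move=> w; apply/ffunP=> x; rewrite !ffunE permKV.
rewrite -(card_imset _ (can_inj wK)); apply: eq_card => w.
apply/imsetP/setIdP=> [[u /setIdP[Wu /andP[uP uS]] ->]|[Ww /andP[wP wS]]].
  by rewrite wcomp_words // !compatible_wcomp uP uS.
exists (wcomp w s^-1%g); last by apply/ffunP=> x; rewrite !ffunE permK.
by rewrite inE wcomp_words ?perm_onV // !compatible_wcomp !actK wP wS.
Qed.

Lemma wcount2_mact P S s : perm_on A s ->
  wcount2 (mact P s) (mact S s) = wcount2 P S.
Proof.
move=> onA; have onAV := perm_onV onA.
rewrite /wcount2 (reindex_inj (act_inj 'P^*^* s)) /=; apply: eq_big => M.
  apply/idP/idP=> MM; last by rewrite -{1}(perm_on_imset onA) mact_matchings.
  by rewrite -(actK 'P^*^* s M) -(perm_on_imset onAV) mact_matchings.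
by move=> _; rewrite !wcount_mact.
Qed.

(* wcount2 P S counts triples (w, M, w'). Modulo p only those fixed by g count, and a single cycle
   of g acts on the latter without fixed points. *)
Lemma wcount2_eq0 P S g : P \in matchings A -> S \in matchings A ->
  perm_on A g -> (g ^+ p = 1)%g -> g != 1%g ->
  mact P g = P -> mact S g = S -> wcount2 P S = 0.
Proof.
move=> MP MS onA gp ng Pg Sg.
pose D := [set t : word * {set {set T}} * word |
  [&& t.1.1 \in words, compatible t.1.1 P, compatible t.1.1 t.1.2,
      t.1.2 \in matchings A, t.2 \in words, compatible t.2 t.1.2 & compatible t.2 S]].
have memD w M w' : ((w, M, w') \in D) =
  [&& w \in words, compatible w P, compatible w M, M \in matchings A,
      w' \in words, compatible w' M & compatible w' S] by rewrite in_set.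
have card_sum (Q : pred word) :
    #|[set w in words | Q w]|%:R = \sum_(w : word) ((w \in words) && Q w)%:R :> F.
  rewrite -sum1_card natr_sum big_mkcond /=; apply: eq_bigr => w _.
  by rewrite in_set; case: ifP.
have -> : wcount2 P S = \sum_(t in D) 1.
  transitivity (\sum_(w : word) \sum_(M : {set {set T}}) \sum_(w' : word)
      (if (w, M, w') \in D then 1 else 0 : F)); last first.
    rewrite pair_bigA /= pair_bigA /= [RHS]big_mkcond /=.
    by apply: eq_bigr => -[[w M] w'] _.
  rewrite exchange_big /= /wcount2 big_mkcond; apply: eq_bigr => M _.
  case: ifP => MM; last first.
    by rewrite big1 // => w _; rewrite big1 // => w' _; rewrite inE /= MM !andbF.
  rewrite /wcount !card_sum mulr_suml; apply: eq_bigr => w _.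
  rewrite mulr_sumr; apply: eq_bigr => w' _; rewrite memD MM -natrM mulnb.
  by rewrite -!andbA /=; case: ifP.
(* The matching is moved by the inverse because [wcomp w s] is compatible with a matching exactly
   when [w] is compatible with its image under [s]. *)
pose h s (t : word * {set {set T}} * word) := (wcomp t.1.1 s, mact t.1.2 s^-1%g, wcomp t.2 s).
have h_iter k s t : iter k (h s) t = h (s ^+ k)%g t.
  elim: k => [|k IHk]; last first.
    rewrite iterS IHk /h /= -actM -invMg -expgS.
    by congr (_, _, _); apply/ffunP=> x; rewrite !ffunE expgS permM.
  rewrite /h invg1 act1; case: t => [[w M] w'] /=.
  by congr (_, _, _); apply/ffunP=> x; rewrite ffunE perm1.
have [x0 gx0] : exists x0, g x0 != x0.
  apply/existsP; apply: contraNT ng; rewrite negb_exists => /forallP gid.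
  by apply/eqP/permP=> x; rewrite perm1; apply/eqP; have := gid x; rewrite negbK.
have Ax0 : x0 \in A by apply: contraNT gx0 => nA; rewrite (out_perm onA).
have h1 t : h 1%g t = t by rewrite -[1%g](expg0 g) -h_iter.
rewrite (sum_iter_fix F_char (f := h g)) //; first last.
- move=> [[w M] w']; rewrite memD /h memD /= => /and5P[Ww wP wM MM /and3P[Ww' wM' wS']].
  rewrite !compatible_wcomp !actKV Pg Sg !wcomp_words // wP wM wM' wS' !andbT /=.
  by rewrite -(perm_on_imset (perm_onV onA)) mact_matchings.
- by move=> t; rewrite h_iter gp h1.
pose z := restr_perm (porbit g x0) g.
have gO y : (g y \in porbit g x0) = (y \in porbit g x0).
  by have := porbit_perm g 1 y; rewrite expg1 => e; rewrite porbit_sym e porbit_sym.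
have zE x : z x = if x \in porbit g x0 then g x else x.
  case: ifP => Ox; last by apply: (out_perm (restr_perm_on _ _)); rewrite Ox.
  apply: restr_permE => //; rewrite !inE; apply/subsetP=> y Oy.
  by rewrite inE /= apermE gO.
have gz : (g * z = z * g)%g.
  by apply/permP=> x; rewrite !permM !zE gO; case: ifP.
have zk k x : (z ^+ k)%g x = if x \in porbit g x0 then (g ^+ k)%g x else x.
  elim: k => [|k IHk]; first by rewrite !perm1; case: ifP.
  rewrite !expgSr !permM IHk zE; case: (boolP (x \in _)) => [Ox|/negPf->] //.
  by rewrite porbit_sym porbit_perm porbit_sym Ox.
have zp : (z ^+ p = 1)%g.
  by apply/permP=> x; rewrite zk gp !perm1; case: ifP.
have onAz : perm_on A z.
  apply/subsetP=> x; rewrite inE zE; case: ifP => [_|]; last by rewrite eqxx.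
  by move=> gx; apply: (subsetP onA); rewrite inE.
(* Only the middle matching moves. Words fixed by [g] are constant on its cycles, hence fixed by
   [z], so all compatibilities persist. *)
pose f (t : word * {set {set T}} * word) := (t.1.1, mact t.1.2 z, t.2).
pose D' := [set t in D | h g t == t].
rewrite (_ : \sum_(t in D | _) 1 = \sum_(t in D') 1); last first.
  by apply: eq_bigl => t; rewrite [RHS]inE.
rewrite (sum_iter_fix F_char (f := f)) //.
- rewrite big_pred0 // => -[[w M] w']; apply/negbTE/negP=> /andP[].
  rewrite in_set => /andP[]; rewrite memD => /and5P[_ _ _ MM _] /eqP[_ Mg _] /eqP[Mz].
  have /eqP := Mz; apply/negP; apply: (mact_cycle_free p_odd gp gx0 Ax0 MM _ zE).
  by rewrite -{1}Mg actKV.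
- move=> [[w M] w']; rewrite /f.
  have -> : iter p f (w, M, w') = (w, mact M (z ^+ p)%g, w').
    by elim: (p) => [|k IHk]; rewrite ?act1 // iterS IHk /f /= expgSr actM.
  by rewrite zp act1.
move=> [[w M] w']; rewrite in_set => /andP[]; rewrite memD.
move=> /and5P[Ww wP wM MM /and3P[Ww' wM' wS']] /eqP[wg Mg wg'].
have wz (u : word) : wcomp u g = u -> wcomp u z = u.
  move=> ug; apply/ffunP=> x; rewrite ffunE zE; case: ifP => // _.
  by have := congr1 (fun v : word => v x) ug; rewrite ffunE.
have zgV : (z * g^-1 = g^-1 * z)%g by apply: (mulgI g); rewrite mulKVg mulgA gz mulgK.
rewrite /f in_set memD /h /= -!compatible_wcomp !wz // Ww wP wM Ww' wM' wS' wg wg' /=.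
have {}Mg : mact M g^-1%g = M by [].
rewrite -actM zgV actM Mg eqxx andbT.
by rewrite -(perm_on_imset onAz) mact_matchings.
Qed.

End Words.

(** * Gaussian expectations of minors *)

Lemma det_bordered (R : comNzRingType) n (V : 'M[R]_n) (w : 'cV_n) (u : 'rV_n) (s : 'M_1) :
  \det (block_mx V w u s) = \det V * s 0 0 - (u *m \adj V *m w) 0 0.
Proof.
(* Over {poly R} the matrix V + 'X is regular: multiply by the adjugate and cancel. *)
pose V' : 'M[{poly R}]_n := char_poly_mx (- V).
have key : \det (block_mx V' (map_mx polyC w) (map_mx polyC u) (map_mx polyC s))
    = \det V' * (s 0 0)%:P - (map_mx polyC u *m \adj V' *m map_mx polyC w) 0 0.
  have d_reg : GRing.lreg (\det V') by apply/monic_lreg/char_poly_monic.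
  have d_regn : GRing.lreg (\det V' ^+ n) by apply: lregX.
  apply: d_regn.
  pose K : 'M[{poly R}]_(n + 1) :=
    block_mx (\adj V') (- (\adj V' *m map_mx polyC w)) 0 (\det V')%:M.
  have detK : \det K = \det V' ^+ n.
    by rewrite det_ublock det_scalar1 -det_mulmx mul_adj_mx det_scalar.
  rewrite -{1}detK mulrC -det_mulmx mulmx_block !mulmx0 !addr0 mulmxN mulmxA mul_mx_adj.
  rewrite mul_mx_scalar mul_scalar_mx addNr det_lblock det_scalar; congr (_ * _).
  rewrite det_mx11 mulmxN mul_mx_scalar mulmxA [LHS]mxE addrC; congr (_ + _).
    by rewrite !mxE.
  by rewrite [LHS]mxE.
have evC m1 m2 (M : 'M[R]_(m1, m2)) : map_mx (horner_eval 0) (map_mx polyC M) = M.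
  by apply/matrixP=> i j; rewrite !mxE /= /horner_eval hornerC.
have evV : map_mx (horner_eval 0) V' = V.
  apply/matrixP=> i j; rewrite !mxE /= /horner_eval !hornerE hornerMn hornerX.
  by rewrite mul0rn sub0r opprK.
have -> : \det (block_mx V w u s) = horner_eval 0
    (\det (block_mx V' (map_mx polyC w) (map_mx polyC u) (map_mx polyC s))).
  by rewrite -det_map_mx map_block_mx evV !evC.
rewrite key rmorphB rmorphM /= -det_map_mx evV; congr (_ * _ - _).
  by rewrite /horner_eval hornerC.
transitivity (map_mx (horner_eval 0)
    (map_mx polyC u *m \adj V' *m map_mx polyC w) 0 0); first by rewrite [RHS]mxE.
by rewrite !map_mxM map_mx_adj evV !evC.
Qed.

(** * Derivations, polarisation and leading minors *)

Section GaussianFunctional.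

Variables (F : fieldType) (A : comNzRingType) (N : nat).
Variables (g : nat -> nat -> A) (d : nat -> nat -> A -> A) (E : {additive A -> F}).
Hypothesis d_add : forall i j x y, d i j (x + y) = d i j x + d i j y.
Hypothesis d_mul : forall i j x y, d i j (x * y) = d i j x * y + x * d i j y.
Hypothesis d_g : forall i j k l, (i < N)%N -> (j < N)%N -> (k < N)%N -> (l < N)%N ->
  d i j (g k l) = ((k == i) && (l == j))%:R.
Hypothesis E_parts : forall i j x, (i < N)%N -> (j < N)%N -> E (g i j * x) = E (d i j x).

Section Derivation.

Variable e : A -> A.
Hypothesis e_add : forall x y, e (x + y) = e x + e y.
Hypothesis e_mul : forall x y, e (x * y) = e x * y + x * e y.

Lemma derivation0 : e 0 = 0.
Proof. by apply: (addrI (e 0)); rewrite -e_add !addr0. Qed.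

Lemma derivation1 : e 1 = 0.
Proof. by apply: (addrI (e 1)); rewrite addr0 -{3}(mulr1 1) e_mul mulr1 mul1r. Qed.

Lemma derivationN x : e (- x) = - e x.
Proof. by apply: (addrI (e x)); rewrite -e_add !subrr derivation0. Qed.

Lemma derivation_sum (I : Type) (s : seq I) (P : pred I) (f : I -> A) :
  e (\sum_(i <- s | P i) f i) = \sum_(i <- s | P i) e (f i).
Proof. by apply: (big_morph e) => //; apply: derivation0. Qed.

Lemma derivation_sign b : e ((-1) ^+ b) = 0.
Proof.
elim: b => [|b IHb]; first exact: derivation1.
by rewrite exprS e_mul derivationN derivation1 oppr0 mul0r IHb mulr0 addr0.
Qed.

Lemma derivation_det_eq0 n (M : 'M[A]_n) :
  (forall i j, e (M i j) = 0) -> e (\det M) = 0.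
Proof.
move=> eM; rewrite derivation_sum big1 // => s _.
rewrite e_mul derivation_sign mul0r add0r.
suff -> : e (\prod_i M i (s i)) = 0 by rewrite mulr0.
by apply: (big_rec (fun y => e y = 0)) => [|i y _ ey]; rewrite ?derivation1 // e_mul eM ey mul0r mulr0 addr0.
Qed.

Lemma derivation_cofactor_eq0 n (M : 'M[A]_n) a b :
  (forall i j, i != a -> e (M i j) = 0) -> e (cofactor M a b) = 0.
Proof.
move=> eM; rewrite /cofactor e_mul derivation_sign mul0r add0r.
rewrite derivation_det_eq0 ?mulr0 // => i j.
by rewrite !mxE eM // eq_sym neq_lift.
Qed.

End Derivation.

Definition lead_minor c : A := \det (\matrix_(i < c, j < c) g i j).

(** Capelli's polarisation operator on the first [r] columns: the derivation that substitutes row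
    [i] for row [k]. *)
Definition polar r i k (x : A) : A := \sum_(0 <= j < r) g i j * d k j x.

Lemma polarD r i k x y : polar r i k (x + y) = polar r i k x + polar r i k y.
Proof. by rewrite -big_split; apply: eq_bigr => j _; rewrite d_add mulrDr. Qed.

Lemma polarM r i k x y : polar r i k (x * y) = polar r i k x * y + x * polar r i k y.
Proof.
rewrite mulr_suml mulr_sumr -big_split; apply: eq_bigr => j _.
by rewrite d_mul mulrDr mulrA mulrCA.
Qed.

(** The substitution yields entry (i, k) of the matrix times its adjugate: a determinant with a
    repeated row if i < k, the minor itself if i = k. If k >= c, row k does not occur in the
    minor. *)
Lemma polar_minor r i k c : (r <= N)%N -> (c <= r)%N -> (i <= k)%N -> (k < r)%N ->
  polar r i k (lead_minor c) = ((i == k) && (k < c)%N)%:R * lead_minor c.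
Proof.
move=> rN cr ik kr; pose M := \matrix_(a < c, b < c) g a b.
have polar_g a b : (a < c)%N -> (b < c)%N ->
    polar r i k (g a b) = (a == k)%:R * g i b.
  move=> ac bc; rewrite /polar big_mkord.
  have br : (b < r)%N by apply: leq_trans cr.
  rewrite (bigD1 (Ordinal br)) //= big1 => [|j nj].
    by rewrite d_g ?(leq_trans kr) ?(leq_trans br) ?(leq_trans ac) ?(leq_trans cr) // eqxx andbT addr0 mulrC.
  rewrite d_g ?(leq_trans kr) ?(leq_trans (ltn_ord j)) ?(leq_trans ac) ?(leq_trans br) ?(leq_trans cr) //.
  case: (b =P j :> nat) => [e|_]; last by rewrite andbF mulr0.
  by case/eqP: nj; apply: val_inj.
have [kc|ck] := ltnP k c; last first.
  rewrite andbF mul0r; apply: (derivation_det_eq0 (polarD r i k) (polarM r i k)) => a b.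
  by rewrite mxE polar_g // (ltn_eqF (leq_trans (ltn_ord a) ck)) mul0r.
rewrite andbT; pose ko := Ordinal kc; pose io := Ordinal (leq_ltn_trans ik kc).
rewrite /lead_minor -/M (expand_det_row M ko) (derivation_sum (polarD r i k)).
transitivity ((M *m \adj M) io ko).
  rewrite mxE; apply: eq_bigr => b _; rewrite polarM.
  rewrite (derivation_cofactor_eq0 (polarD r i k) (polarM r i k)) => [|a b' na].
    by rewrite mulr0 addr0 !mxE polar_g // eqxx mul1r.
  rewrite mxE polar_g // (_ : (a == k :> nat) = false) ?mul0r //.
  by apply/negbTE; apply: contraNneq na => ak; apply/eqP/val_inj.
rewrite mul_mx_adj -(expand_det_row M ko) mxE mulr_natl; congr (_ *+ _).
Qed.

Definition gram r k : 'M[A]_k :=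
  (\matrix_(i < k, j < r) g i j) *m (\matrix_(i < k, j < r) g i j)^T.

(** Isolates row k for integration by parts: the matrix of the quadratic form involves only the rows
    before it. *)
Lemma gram_bordered r k (X := \matrix_(i < k, j < r) g i j) (x := \row_(j < r) g k j) :
  \det (gram r (k + 1))
  = (x *m ((\det (gram r k))%:M - X^T *m \adj (gram r k) *m X) *m x^T) 0 0.
Proof.
rewrite /gram; set Y := \matrix_(i < k + 1, j < r) g i j.
have -> : Y = col_mx X x.
  apply/matrixP=> i j; rewrite !mxE; case: splitP => i' iE; rewrite !mxE iE //.
  by rewrite ord1 addn0.
rewrite tr_col_mx mul_col_row det_bordered -/X.
rewrite mulmxBr mulmxBl [RHS]mxE; congr (_ + _).
  by rewrite mul_mx_scalar -scalemxAl [RHS]mxE.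
by rewrite [RHS]mxE !mulmxA.
Qed.

(** The Gram determinant is the sum of the g k j y j with y linear in row k; integrate by parts.
    Differentiating y gives the trace of [M]. Differentiating [H] gives det V times [polar r k k H],
    up to multiples of [polar r i k H] for i < k, which vanish. *)
Lemma gaussian_gram_rec r k H h : (r <= N)%N -> (k < r)%N ->
  (forall i, (i < k)%N -> polar r i k H = 0) -> polar r k k H = h%:R * H ->
  E (\det (gram r (k + 1)) * H) = (h + (r - k))%:R * E (\det (gram r k) * H).
Proof.
move=> rN kr Hlow Hk; pose X := \matrix_(i < k, j < r) g i j; pose x := \row_(j < r) g k j.
pose V := gram r k; pose K := X^T *m \adj V *m X; pose M := (\det V)%:M - K.
have kN := leq_trans kr rN; have jN (j : 'I_r) : (j < N)%N := leq_trans (ltn_ord j) rN.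
have dX (j : 'I_r) i l : d k j (X i l) = 0.
  rewrite mxE d_g // ?(ltn_trans (ltn_ord i)) //.
  by rewrite (ltn_eqF (ltn_ord i)).
have dV (j : 'I_r) a b : d k j (V a b) = 0.
  have -> : V a b = \sum_l X a l * X b l.
    by rewrite mxE; apply: eq_bigr => l _; congr (_ * _); rewrite mxE.
  rewrite (derivation_sum (d_add k j)) big1 // => l _.
  by rewrite d_mul !dX mul0r mulr0 addr0.
have dM (j : 'I_r) a b : d k j (M a b) = 0.
  have ddet := derivation_det_eq0 (d_add k j) (d_mul k j) (dV j).
  have -> : M a b = (\det V) *+ (a == b) - \sum_c (\sum_c' X c' a * \adj V c' c) * X c b.
    rewrite !mxE; congr (_ - _); apply: eq_bigr => c _; congr (_ * _).
      by rewrite mxE; apply: eq_bigr => c' _; rewrite mxE.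
  have dadj c' c : d k j (\adj V c' c) = 0.
    rewrite mxE; apply: (derivation_cofactor_eq0 (d_add k j) (d_mul k j)) => *.
    exact: dV.
  rewrite d_add (derivationN (d_add k j)) (derivation_sum (d_add k j)).
  rewrite big1 ?oppr0 ?addr0 => [|c _].
    by case: (a == b); rewrite ?mulr1n ?mulr0n ?ddet // (derivation0 (d_add k j)).
  rewrite d_mul dX mulr0 addr0 (derivation_sum (d_add k j)) big1 ?mul0r // => c' _.
  by rewrite d_mul dX dadj mul0r mulr0 addr0.
pose y (j : 'I_r) : A := (M *m x^T) j 0.
have dy (j : 'I_r) : d k j (y j) = M j j.
  rewrite /y mxE (derivation_sum (d_add k j)) (bigD1 j) //= big1 ?addr0 => [|l nl].
    by rewrite d_mul dM mul0r add0r !mxE d_g ?eqxx ?mulr1.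
  rewrite d_mul dM mul0r add0r !mxE d_g // eqxx /= (_ : (l == j :> nat) = false) ?mulr0 //.
  exact/negbTE.
(* The trace of [K] is that of adj V times X X^T = V, namely k det V. *)
have trM : \tr M = (r - k)%:R * \det V.
  rewrite raddfB /= mxtrace_scalar /K -mulmxA mxtrace_mulC -mulmxA -/(gram r k) -/V.
  by rewrite mul_adj_mx mxtrace_scalar -mulrnBr ?mulr_natl // ltnW.
have sumd : \sum_(j < r) d k j (y j * H) = (h + (r - k))%:R * (\det V * H).
  under eq_bigr do rewrite d_mul dy; rewrite big_split /= -mulr_suml -/(\tr M) trM.
  have -> : \sum_(j < r) y j * d k j H = \det V * polar r k k H.
    pose z := \adj V *m (X *m x^T).
    have yE (j : 'I_r) : y j = \det V * g k j - \sum_i z i 0 * g i j.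
      rewrite /y mulmxBl mxE; congr (_ + _).
        by rewrite mul_scalar_mx !mxE.
      rewrite mxE /K -!mulmxA -/z mxE; congr (- _); apply: eq_bigr => i _.
      by rewrite mulrC; congr (_ * _); rewrite !mxE.
    under eq_bigr do rewrite yE mulrBl [X in _ - X]mulr_suml.
    rewrite big_split /= sumrN exchange_big /= [X in - X]big1 ?oppr0 ?addr0.
      by rewrite /polar big_mkord mulr_sumr; apply: eq_bigr => j _; rewrite mulrA.
    move=> i _; have := Hlow i (ltn_ord i); rewrite /polar big_mkord => Hi.
    transitivity (z i 0 * \sum_(j < r) g i j * d k j H); last by rewrite Hi mulr0.
    by rewrite mulr_sumr; apply: eq_bigr => j _; rewrite mulrA.
  rewrite Hk natrD; ring.
have detE : \det (gram r (k + 1)) = \sum_(j < r) g k j * y j.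
  rewrite gram_bordered -mulmxA mxE; apply: eq_bigr => j _.
  by rewrite mxE.
rewrite detE mulr_suml raddf_sum /=.
rewrite (eq_bigr (fun j : 'I_r => E (d k j (y j * H)))) => [|j _]; last first.
  by rewrite -mulrA E_parts.
by rewrite -raddf_sum sumd !mulr_natl raddfMn.
Qed.

Lemma polar_minors r i k (t : seq nat) : (r <= N)%N -> all (fun c => (c <= r)%N) t ->
  (i <= k)%N -> (k < r)%N ->
  polar r i k (\prod_(c <- t) lead_minor c ^+ 2)
  = ((i == k) * (2 * count (fun c => (k < c)%N) t))%:R * \prod_(c <- t) lead_minor c ^+ 2.
Proof.
move=> rN + ik kr; elim: t => [|c t IHt] /= => [_|/andP[cr tr]].
  by rewrite big_nil muln0 muln0 mul0r (derivation1 (polarM r i k)).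
rewrite !big_cons polarM IHt // expr2 polarM polar_minor //.
by case: (i == k); case: (k < c)%N; rewrite /= ?mul1n ?mul0n ?add1n ?add0n ?mulnDr ?mulnS ?natrD; ring.
Qed.

(** The squared minor is a Gram determinant, stripped row by row. In the diagram with column heights
    [l :: t], the box in row k of the first column has leg l - k - 1, and its arm counts the heights
    in [t] exceeding k; so each factor is a hook number, twice the arm plus the leg plus 1. *)
Lemma gaussian_minors_rec l (t : seq nat) : (l <= N)%N -> all (fun c => (c <= l)%N) t ->
  E (lead_minor l ^+ 2 * \prod_(c <- t) lead_minor c ^+ 2) =
  (\prod_(k < l) (2 * count (fun c => (k < c)%N) t + (l - k)))%:R
     * E (\prod_(c <- t) lead_minor c ^+ 2).
Proof.
move=> lN tl; set H := \prod_(c <- t) _.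
have -> : lead_minor l ^+ 2 = \det (gram l l).
  by rewrite /gram det_mulmx det_tr.
suff Q k : (k <= l)%N -> E (\det (gram l k) * H)
    = (\prod_(i < k) (2 * count (fun c => (i < c)%N) t + (l - i)))%:R * E H.
  exact: Q.
elim: k => [|k IHk] kl; first by rewrite det_mx00 mul1r big_ord0 mul1r.
rewrite -addn1 (@gaussian_gram_rec _ _ _ (2 * count (fun c => (k < c)%N) t)) //.
- by rewrite IHk 1?ltnW // addn1 big_ord_recr /= natrM mulrA [_%:R * _%:R]mulrC.
- by move=> i ik; rewrite polar_minors ?(ltn_eqF ik) ?mul0n ?mul0r // ltnW.
by rewrite polar_minors // eqxx mul1n.
Qed.

End GaussianFunctional.

(* The k-th moment of a standard Gaussian variable. *)
Fixpoint nb_pairings k : nat :=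
  match k with 0 => 1 | 1 => 0 | (k'.+1 as k1).+1 => k1 * nb_pairings k' end.

(** * The formal Gaussian expectation on polynomials *)

Section MultivariateGaussian.

Variables (F : fieldType) (n : nat).

Definition gauss_mnm (m : 'X_{1..n}) : F := \prod_(i < n) (nb_pairings (m i))%:R.

Definition gauss (q : {mpoly F[n]}) : F := \sum_(m <- msupp q) q@_m * gauss_mnm m.

Lemma gaussE q k : (msize q <= k)%N ->
  gauss q = \sum_(m : 'X_{1..n < k}) q@_m * gauss_mnm m.
Proof.
move=> le_qk; rewrite /gauss (big_mksub ('X_{1..n < k} : subFinType _)) ?msupp_uniq //=; first last.
  by move=> x /msize_mdeg_lt /leq_trans; apply.
by rewrite big_rmcond //= => j /memN_msupp_eq0 ->; rewrite mul0r.
Qed.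

Lemma gauss_is_zmod_morphism : zmod_morphism gauss.
Proof.
move=> q1 q2; pose k := maxn (msize (q1 - q2)) (maxn (msize q1) (msize q2)).
rewrite !(@gaussE _ k) ?leq_max ?leqnn ?orbT // -sumrB; apply: eq_bigr => m _.
by rewrite mcoeffB mulrBl.
Qed.

HB.instance Definition _ :=
  GRing.isZmodMorphism.Build {mpoly F[n]} F gauss gauss_is_zmod_morphism.

Lemma gaussZX c m : gauss (c *: 'X_[m]) = c * gauss_mnm m.
Proof.
pose k := maxn (msize (c *: 'X_[m] : {mpoly F[n]})) (mdeg m).+1.
rewrite (@gaussE _ k) ?leq_maxl //.
have mk : (mdeg m < k)%N by rewrite leq_max ltnSn orbT.
rewrite (bigD1 (BMultinom mk)) //= big1 => [|m' nm'].
  by rewrite mcoeffZ mcoeffX eqxx mulr1 addr0.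
rewrite mcoeffZ mcoeffX (_ : (m == m') = false) ?mulr0 ?mul0r //.
by apply/negbTE; apply: contraNneq nm' => e; apply/eqP/val_inj.
Qed.

Lemma gauss1 : gauss 1 = 1.
Proof.
rewrite -[1](scale1r 1) -mpolyX0 gaussZX mul1r /gauss_mnm big1 // => i _.
by rewrite mnm0E.
Qed.

(** On monomials this is the moment recursion: the moment of order k+1 is k times that of order
    k-1. *)
Lemma gauss_parts i q : gauss ('X_i * q) = gauss q^`M(i).
Proof.
elim/mpolyind: q => [|c m q _ _ IHq]; first by rewrite mulr0 mderiv0.
rewrite mulrDr mderivD !raddfD /= IHq; congr (_ + _).
rewrite -scalerAr -mpolyXD mderivZ mderivX scalerA !gaussZX -mulrA.
congr (_ * _); rewrite /gauss_mnm (bigD1 i) //= [X in _ = _ * X](bigD1 i) //= mulrA.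
rewrite mnmDE mnmBE mnm1E eqxx; congr (_ * _).
  by case: (m i) => [|k]; rewrite ?mul0r // subn1 -natrM.
apply: eq_bigr => j nj; rewrite mnmDE mnmBE mnm1E eq_sym (negPf nj).
by rewrite add0n subn0.
Qed.

End MultivariateGaussian.

Lemma gaussian_functional (F : fieldType) (N : nat) :
  exists (A : comNzRingType) (g : nat -> nat -> A) (d : nat -> nat -> A -> A)
    (E : {additive A -> F}),
  [/\ forall i j x y, d i j (x + y) = d i j x + d i j y,
      forall i j x y, d i j (x * y) = d i j x * y + x * d i j y,
      forall i j k l, (i < N)%N -> (j < N)%N -> (k < N)%N -> (l < N)%N ->
        d i j (g k l) = ((k == i) && (l == j))%:R,
      forall i j x, (i < N)%N -> (j < N)%N -> E (g i j * x) = E (d i j x)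
    & E 1 = 1].
Proof.
case: N => [|N].
  exists {mpoly F[0]}, (fun _ _ => 0), (fun _ _ _ => 0), (gauss (n := 0)).
  split=> // [i j x y|i j x y|]; first by rewrite addr0.
    by rewrite mul0r mulr0 addr0.
  exact: gauss1.
(* One polynomial variable for each entry of a square matrix, numbered through [mxvec_index]. *)
pose v i j : 'I_(N.+1 * N.+1) := mxvec_index (inord i : 'I_N.+1) (inord j : 'I_N.+1).
have v_eq i j k l : (i < N.+1)%N -> (j < N.+1)%N -> (k < N.+1)%N -> (l < N.+1)%N ->
    (v k l == v i j) = (k == i) && (l == j).
  move=> iN jN kN lN; apply/eqP/andP=> [e|[/eqP-> /eqP->]] //.
  have := congr1 (fun x => (enum_val (cast_ord (esym (mxvec_cast N.+1 N.+1)) x))) e.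
  rewrite /v /mxvec_index !cast_ordK !enum_rankK => -[/(congr1 (@nat_of_ord _)) e1 /(congr1 (@nat_of_ord _)) e2].
  by rewrite !inordK // in e1 e2; rewrite e1 e2 !eqxx.
exists {mpoly F[N.+1 * N.+1]}, (fun i j => 'X_(v i j)), (fun i j q => q^`M(v i j)), (gauss (n := _)).
split=> [i j x y|i j x y|i j k l iN jN kN lN|i j x _ _|].
- exact: mderivD.
- exact: mderivM.
- rewrite mderivX mnm1E v_eq //; case: andP => [[/eqP-> /eqP->]|_]; last by rewrite scale0r.
  rewrite scale1r -mpolyX0; congr 'X_[_].
  by apply/mnmP=> a; rewrite mnmBE subnn mnm0E.
- exact: gauss_parts.
exact: gauss1.
Qed.

(** * The eigenvalue of the word kernel *)

Lemma sum_card_fiber (I C : finType) (h : I -> C) (P : pred I) :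
  (\sum_c #|[set i | (h i == c) && P i]|)%N = #|[set i | P i]|.
Proof.
rewrite -[RHS]sum1_card (partition_big h predT) //=; apply: eq_bigr => c _.
by rewrite sum1dep_card; apply: eq_card => i; rewrite !inE andbC.
Qed.

Section Eigenvector.

Variables (T : finType) (A : {set T}) (R K : nat) (io : 'I_K -> T).
Hypotheses (io_inj : injective io) (io_im : io @: setT = A).
Variables (C : finType) (row : 'I_K -> 'I_R.+1) (col : 'I_K -> C).
Hypothesis cell_inj : forall i j, col i = col j -> row i = row j -> i = j.
Hypothesis cell_closed : forall i (a : 'I_R.+1), (a <= row i)%N ->
  exists2 j, col j = col i & row j = a.

Local Notation word := {ffun T -> 'I_R.+1}.

(** ['I_K] numbers the cells of a diagram, placed on [A] by [io]; by [cell_closed] each column fills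
    an initial segment of rows. Words are to have as many letters c as there are cells in row c. *)
Definition content (c : 'I_R.+1) := #|[set i | row i == c]|.

Local Notation W := (words A content).

Lemma io_in i : io i \in A. Proof. by rewrite -io_im imset_f. Qed.

Definition mkword (f : 'I_K -> 'I_R.+1) : word :=
  [ffun x => if [pick i | io i == x] is Some i then f i else ord0].

Lemma mkwordE f i : mkword f (io i) = f i.
Proof.
rewrite ffunE; case: pickP => [j /eqP/io_inj->//|/(_ i)]; by rewrite eqxx.
Qed.

Lemma word_count (w : word) c :
  #|[set x in A | w x == c]| = #|[set i | w (io i) == c]|.
Proof.
rewrite -(card_imset _ io_inj); apply: eq_card => x; apply/setIdP/imsetP.
  case; rewrite -io_im => /imsetP[i _ ->] wi; exists i => //; by rewrite inE.
by case=> i; rewrite inE => wi ->; rewrite io_in.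
Qed.

Lemma mkword_words (s : 'S_K) : mkword (row \o s) \in W.
Proof.
apply/wordsP; split=> [x nAx|c].
  rewrite ffunE; case: pickP => // i /eqP e.
  by rewrite -e io_in in nAx.
rewrite word_count /content -[RHS](card_imset _ (@perm_inj _ s^-1)).
apply: eq_card => i; rewrite inE mkwordE; apply/idP/imsetP => /=.
  by move=> si; exists (s i); rewrite ?inE // permK.
by case=> j; rewrite inE => rj ->; rewrite permKV.
Qed.

Lemma words_eq (w1 w2 : word) : w1 \in W -> w2 \in W ->
  (forall i, w1 (io i) = w2 (io i)) -> w1 = w2.
Proof.
move=> /wordsP[w10 _] /wordsP[w20 _] e; apply/ffunP=> x.
case: (boolP (x \in A)) => [|nA]; last by rewrite w10 ?w20.
by rewrite -io_im => /imsetP[i _ ->].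
Qed.

(* In each column a word with distinct letters has at most as many letters <= a as row does,
   and the totals over all columns agree. *)
Lemma column_injective_word (w : word) : w \in W ->
  (forall i j, col i = col j -> w (io i) = w (io j) -> i = j) ->
  exists s : 'S_K, forall i, col (s i) = col i /\ row (s i) = w (io i).
Proof.
move=> Ww w_inj.
pose X c a := [set i | (col i == c) && (w (io i) <= a)%N].
pose Y c a := [set i | (col i == c) && (row i <= a)%N].
have leXY c (a : 'I_R.+1) : (#|X c a| <= #|Y c a|)%N.
  case: (boolP [forall i, (col i == c) ==> (row i <= a)%N]) => [/forallP all_le|].
    apply/subset_leq_card/subsetP=> i; rewrite !inE => /andP[ci _].
    by rewrite ci (implyP (all_le i)).
  rewrite negb_forall => /existsP[i0]; rewrite negb_imply -ltnNge => /andP[/eqP ci0 ai0].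
  have -> : #|X c a| = #|(fun i => w (io i)) @: X c a|.
    rewrite card_in_imset // => i j; rewrite !inE => /andP[/eqP ci _] /andP[/eqP cj _].
    by apply: w_inj; rewrite ci cj.
  apply: leq_trans (leq_imset_card row _); apply/subset_leq_card/subsetP=> b.
  case/imsetP=> i; rewrite inE => /andP[_ wa] ->.
  have [j cj rj] := @cell_closed i0 (w (io i)) (leq_trans wa (ltnW ai0)).
  by apply/imsetP; exists j; rewrite // inE cj ci0 eqxx rj.
have totXY a : #|[set i | (w (io i) <= a)%N]| = #|[set i | (row i <= a)%N]|.
  rewrite -(sum_card_fiber (fun i => w (io i))) -(sum_card_fiber row).
  apply: eq_bigr => b _; have /wordsP[_ /(_ b)] := Ww.
  rewrite word_count /content; case: (leqP b a) => ba.
    have e (h : 'I_K -> 'I_R.+1) : [set i | (h i == b) && (h i <= a)%N] = [set i | h i == b].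
      by apply/setP=> i; rewrite !inE; case: eqP => // ->.
    by rewrite !e.
  have e (h : 'I_K -> 'I_R.+1) : [set i | (h i == b) && (h i <= a)%N] = set0.
    by apply/setP=> i; rewrite !inE; case: eqP => // ->; rewrite leqNgt ba.
  by rewrite !e.
have eqXY c (a : 'I_R.+1) : #|X c a| = #|Y c a|.
  have /eqP : (\sum_c (#|Y c a| - #|X c a|) = 0)%N.
    by rewrite sumnB // /X /Y !sum_card_fiber totXY subnn.
  rewrite sum_nat_eq0 => /forallP/(_ c)/=; rewrite subn_eq0 => leYX.
  by apply/eqP; rewrite eqn_leq leXY.
have col_letter i : exists j, col j = col i /\ row j = w (io i).
  suff [j cj rj] : exists2 j, col j = col i & (w (io i) <= row j)%N.
    by have [k ck rk] := cell_closed rj; exists k; rewrite ck cj.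
  case: (boolP [exists j, (col j == col i) && (w (io i) <= row j)%N]).
    by case/existsP=> j /andP[/eqP cj rj]; exists j.
  rewrite negb_exists => /forallP small.
  have lt_row j : col j = col i -> (row j < w (io i))%N.
    by move=> cj; have := small j; rewrite cj eqxx -ltnNge.
  have w_gt0 : (0 < w (io i))%N by apply: leq_ltn_trans (lt_row i erefl).
  have wR := ltn_ord (w (io i)).
  (* With [a] one less than the letter of [i], every cell of the column would count in [Y] while [i]
     is missing from [X], against [eqXY]. *)
  pose a : 'I_R.+1 := inord (w (io i)).-1.
  have aE : a = (w (io i)).-1 :> nat by rewrite inordK // prednK // ltnW.
  suff : (#|X (col i) a| < #|Y (col i) a|)%N by rewrite eqXY ltnn.
  apply: proper_card; apply/properP; split.
    apply/subsetP=> j; rewrite !inE => /andP[/eqP cj _].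
    by rewrite cj eqxx aE -ltnS prednK // lt_row.
  by exists i; rewrite !inE eqxx aE -ltnS prednK // ?lt_row // ltnn.
pose f i := odflt i [pick j | (col j == col i) && (row j == w (io i))].
have fP i : col (f i) = col i /\ row (f i) = w (io i).
  rewrite /f; case: pickP => [j /andP[/eqP-> /eqP->]//|no].
  by have [j [cj rj]] := col_letter i; have := no j; rewrite cj rj !eqxx.
have f_inj : injective f.
  move=> i j fij; have [ci wi] := fP i; have [cj wj] := fP j.
  by apply: w_inj; [rewrite -ci -cj fij | rewrite -wi -wj fij].
by exists (perm f_inj) => i; rewrite permE.
Qed.

(** Up to the order of the cells this is block diagonal, so it is a product of one determinant per
    column of the diagram. For [g] the identity it is the coefficient of [w] in the antisymmetrised
    word. *)
Definition col_det (B : comNzRingType) (g : nat -> nat -> B) (w : word) : B :=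
  \det (\matrix_(i < K, j < K) if col i == col j then g (w (io i)) (row j) else 0).

Definition row_word := mkword row.

Lemma row_word_words : row_word \in W.
Proof.
suff -> : row_word = mkword (row \o (1 : 'S_K)%g) by apply: mkword_words.
by apply/ffunP=> x; rewrite !ffunE; case: pickP => // i _; rewrite /= perm1.
Qed.

(** Either [w] repeats a letter in a column and two rows of the determinant agree, or [w] is
    [row_word] permuted within columns and a sign comes out. That the integer is independent of [g]
    makes the sign vector an eigenvector. *)
Lemma col_det_words w : w \in W -> exists z : int,
  forall (B : comNzRingType) (g : nat -> nat -> B),
  col_det g w = z%:~R * col_det g row_word.
Proof.
move=> Ww.
case: (boolP [exists i, exists j, [&& i != j, col i == col j & w (io i) == w (io j)]]).
  case/existsP=> i /existsP[j /and3P[nij /eqP cij /eqP wij]]; exists 0 => B g.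
  rewrite mul0r; apply: (determinant_alternate nij) => k.
  by rewrite !mxE cij wij.
rewrite negb_exists => /forallP w_inj.
have [i j cij wij|s sP] := column_injective_word Ww.
  apply/eqP; have := w_inj i; rewrite negb_exists => /forallP/(_ j).
  by rewrite cij wij !eqxx !andbT negbK.
exists ((-1) ^+ s) => B g; rewrite rmorph_sign -det_perm -det_mulmx; congr (\det _).
rewrite -row_permE; apply/matrixP=> i j; rewrite !mxE mkwordE.
by have [-> ->] := sP i.
Qed.

Variables (F : fieldType) (B : comNzRingType) (g : nat -> nat -> B).
Variable E : {additive B -> F}.

Definition sign_word : word -> F := col_det (fun a b => (a == b)%:R).

Lemma sign_row_word : sign_word row_word = 1.
Proof.
rewrite -(det1 F K); congr (\det _); apply/matrixP=> i j; rewrite !mxE mkwordE.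
case: (i =P j) => [->|nij]; first by rewrite !eqxx.
case: eqP => // cij; case: eqP => // /val_inj rij.
by case: nij; apply: cell_inj.
Qed.

Lemma prod_nat_bool (I : finType) (P : pred I) :
  \prod_i (P i)%:R = [forall i, P i]%:R :> F.
Proof.
case: (boolP [forall i, P i]) => [/forallP allP|].
  by rewrite big1 // => i _; rewrite allP.
by rewrite negb_forall => /existsP[i /negPf Pi]; rewrite (bigD1 i) //= Pi mul0r.
Qed.

(** Expand the determinant [sign_word w'] over permutations s. Each column-preserving s selects the
    single word [mkword (row \o s)], the others give 0, and the sum rebuilds the expectation of
    [col_det g w]. *)
Lemma sign_word_eigen w : w \in W ->
  \sum_(w' in W) E (\prod_(x in A) g (w x) (w' x)) * sign_word w'
  = E (col_det g row_word) * sign_word w.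
Proof.
move=> Ww; have [z zP] := col_det_words Ww.
rewrite {2}/sign_word zP -/sign_word sign_row_word mulr1.
transitivity (E (col_det g w)); last by rewrite zP mulrzl raddfMz mulrzr.
have prodE (w' : word) : \prod_(x in A) g (w x) (w' x) = \prod_i g (w (io i)) (w' (io i)).
  rewrite -io_im big_imset /=; last by move=> i j _ _; apply: io_inj.
  by apply: eq_bigl => i; rewrite inE.
rewrite /sign_word /col_det raddf_sum /=.
under eq_bigr do rewrite mulr_sumr.
rewrite exchange_big /=; apply: eq_bigr => s _.
rewrite raddfMsign; under eq_bigr do rewrite mulrCA.
rewrite -mulr_sumr; congr (_ * _).
under [in RHS]eq_bigr do rewrite mxE.
have prod_delta (w' : word) :
    \prod_i (\matrix_(i, j) (if col i == col j then (w' (io i) == row j :> nat)%:R else 0 : F)) i (s i)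
    = [forall i, (col i == col (s i)) && (w' (io i) == row (s i))]%:R.
  by rewrite -prod_nat_bool; apply: eq_bigr => i _; rewrite mxE; case: eqP.
rewrite (eq_bigr (fun w' : word => E (\prod_i g (w (io i)) (w' (io i)))
    * [forall i, (col i == col (s i)) && (w' (io i) == row (s i))]%:R)); last first.
  by move=> w' _; rewrite prodE -prod_delta.
case: (boolP [forall i, col i == col (s i)]) => [/forallP scol|]; last first.
  rewrite negb_forall => /existsP[i nci].
  rewrite (bigD1 i) //= (negPf nci) mul0r raddf0 big1 // => w' _.
  rewrite (_ : [forall _, _] = false) ?mulr0 //; apply/negbTE.
  by rewrite negb_forall; apply/existsP; exists i; rewrite (negPf nci).
rewrite (bigD1 (mkword (row \o s))) ?mkword_words //= [X in _ + X]big1 ?addr0 => [|w' /andP[Ww' nw']].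
  rewrite (_ : [forall _, _] = true) ?mulr1; last first.
    by apply/forallP=> i; rewrite scol mkwordE /= eqxx.
  by congr (E _); apply: eq_bigr => i _; rewrite scol mkwordE.
case: (boolP [forall i, _]) => [/forallP h|]; last by rewrite mulr0.
case/eqP: nw'; apply: words_eq => // [|i]; first exact: mkword_words.
by have /andP[_ /eqP->] := h i; rewrite mkwordE.
Qed.

Variable d : nat -> nat -> B -> B.
Hypothesis d_add : forall i j x y, d i j (x + y) = d i j x + d i j y.
Hypothesis d_mul : forall i j x y, d i j (x * y) = d i j x * y + x * d i j y.
Hypothesis d_g : forall i j k l, (i < R.+1)%N -> (j < R.+1)%N -> (k < R.+1)%N ->
  (l < R.+1)%N -> d i j (g k l) = ((k == i) && (l == j))%:R.
Hypothesis E_parts : forall i j x, (i < R.+1)%N -> (j < R.+1)%N ->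
  E (g i j * x) = E (d i j x).
Hypothesis E1 : E 1 = 1.

Lemma derivation_prod (e : B -> B) (f : T -> B) (X : {set T}) :
  (forall x y, e (x + y) = e x + e y) ->
  (forall x y, e (x * y) = e x * y + x * e y) ->
  e (\prod_(x in X) f x) = \sum_(y in X) e (f y) * \prod_(x in X :\ y) f x.
Proof.
move=> eD eM; have [m] := ubnP #|X|; elim: m X => // m IHm X Xm.
have [->|[y Xy]] := set_0Vmem X.
  by rewrite !big_set0 (derivation1 eM).
rewrite (big_setD1 y Xy) /= eM (big_setD1 y Xy) /=; congr (_ + _).
rewrite IHm; last by move: Xm; rewrite (cardsD1 y) Xy.
rewrite mulr_sumr; apply: eq_bigr => z /setD1P[nzy Xz].
rewrite mulrCA; congr (_ * _).
rewrite [RHS](big_setD1 y) ?inE 1?eq_sym ?nzy //=; congr (_ * _).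
by apply: eq_bigl => x; rewrite !inE andbCA.
Qed.

(* Wick's formula. *)
Lemma gaussian_matchings (u : T -> 'I_R.+1 * 'I_R.+1) (X : {set T}) :
  E (\prod_(x in X) g (u x).1 (u x).2) = (nb_matchings u X)%:R.
Proof.
have [m] := ubnP #|X|; elim: m X => // m IHm X Xm.
have [->|[x Xx]] := set_0Vmem X; first by rewrite big_set0 E1 nb_matchings0.
rewrite (big_setD1 x Xx) /= E_parts // (derivation_prod _ _ (d_add _ _) (d_mul _ _)).
rewrite raddf_sum (nb_matchings_rec _ Xx) natr_sum /= [RHS]big_mkcondr /=.
apply: eq_bigr => y /setD1P[nyx Xy]; rewrite d_g //.
have -> : ((u y).1 == (u x).1 :> nat) && ((u y).2 == (u x).2 :> nat) = (u y == u x).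
  by rewrite !val_eqE -pair_eqE; case: (u y) (u x) => a b [a' b'].
case: eqP => _; last by rewrite mul0r raddf0.
rewrite mul1r -setDDl IHm //.
apply: leq_ltn_trans (subset_leq_card (subD1set _ _)) _.
by move: Xm; rewrite (cardsD1 x) Xx.
Qed.

Local Notation theta := (E (col_det g row_word)).
Local Notation M := (matchings A).
Local Notation wc := (wcount A content F).

Definition word_vector P : F := \sum_(w in W | compatible w P) sign_word w.

(** Being compatible with two words is being compatible with the word of pairs of letters, to which
    Wick's formula applies. *)
Lemma sum_matchings_compatible (w w' : word) :
  \sum_(P in M) (compatible w P && compatible w' P)%:R
  = E (\prod_(x in A) g (w x) (w' x)).
Proof.
rewrite (gaussian_matchings (fun x => (w x, w' x))) /nb_matchings -sum1_card natr_sum.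
rewrite [RHS]big_mkcond [LHS]big_mkcond /=; apply: eq_bigr => P _.
rewrite [X in _ = (if X then _ else _)]in_set.
have -> : compatible (fun x => (w x, w' x)) P = compatible w P && compatible w' P by apply: compatible_pair.
by case: (P \in M) => //=; case: (_ && _).
Qed.

Lemma word_vectorE P : word_vector P = \sum_(w in W) (compatible w P)%:R * sign_word w.
Proof.
rewrite /word_vector big_mkcondr; apply: eq_bigr => w _.
by case: (compatible w P); rewrite ?mul1r ?mul0r.
Qed.

(** Let C be the incidence matrix of words and matchings. Then [wcount] is C^T C, [word_vector] is
    C^T applied to the sign vector, and C C^T is the Gaussian kernel with the sign vector as
    eigenvector. *)
Lemma word_vector_wcount S :
  \sum_(P in M) word_vector P * wc P S = theta * word_vector S.
Proof.
transitivity (\sum_(w' in W) (compatible w' S)%:R *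
    \sum_(w in W) E (\prod_(x in A) g (w' x) (w x)) * sign_word w).
  under [RHS]eq_bigr => w' _ do (rewrite mulr_sumr;
    under eq_bigr => w _ do (rewrite -sum_matchings_compatible mulr_suml mulr_sumr)).
  under [RHS]eq_bigr do rewrite exchange_big.
  rewrite [RHS]exchange_big /=; apply: eq_bigr => P MP.
  rewrite word_vectorE mulr_suml [RHS]exchange_big /=; apply: eq_bigr => w Ww.
  have -> : wc P S = \sum_(w' in W) (compatible w' P && compatible w' S)%:R.
    rewrite /wcount -sum1_card natr_sum big_mkcond [RHS]big_mkcond /=.
    by apply: eq_bigr => w' _; rewrite [X in (if X then _ else _) = _]in_set; case: (w' \in W) => //=; case: (_ && _).
  rewrite mulr_sumr; apply: eq_bigr => w' _.
  by rewrite -!mulnb !natrM; ring.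
rewrite word_vectorE mulr_sumr; apply: eq_bigr => w' Ww'.
by rewrite sign_word_eigen // mulrCA.
Qed.

Lemma word_vector_wcount2 S :
  \sum_(P in M) word_vector P * wcount2 A content F P S = theta ^+ 2 * word_vector S.
Proof.
under eq_bigr do rewrite /wcount2 mulr_sumr.
rewrite exchange_big /= expr2 -mulrA -word_vector_wcount mulr_sumr.
apply: eq_bigr => N _; under eq_bigr do rewrite mulrA.
by rewrite -mulr_suml word_vector_wcount -mulrA.
Qed.

(** Summing [word_vector] over the matchings compatible with [row_word] gives the eigenvalue
    itself. *)
Lemma word_vector_neq0 : theta != 0 -> exists2 P, P \in M & word_vector P != 0.
Proof.
move=> nz; suff [P MP /andP[_ nzP]] : exists2 P, P \in M & true && (word_vector P != 0) by exists P.
apply/exists_inP; apply: contraNT nz; rewrite negb_exists => /forallP all0.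
have <- : \sum_(P in M) (compatible row_word P)%:R * word_vector P = theta.
  transitivity (\sum_(w in W) E (\prod_(x in A) g (row_word x) (w x)) * sign_word w).
    under [RHS]eq_bigr => w _ do rewrite -sum_matchings_compatible mulr_suml.
    rewrite [RHS]exchange_big; apply: eq_bigr => P _.
    rewrite word_vectorE mulr_sumr; apply: eq_bigr => w _.
    by rewrite -mulnb natrM mulrA.
  by rewrite sign_word_eigen ?row_word_words // sign_row_word mulr1.
rewrite big1 // => P MP; have := all0 P.
by rewrite MP /= negbK => /eqP->; rewrite mulr0.
Qed.

End Eigenvector.

(** * Diagrams whose hook numbers are prime to p *)

Section Heights.

Variable p : nat.

(** Weakly decreasing column heights of a diagram; the numbers tested are the hook numbers of the
    first column, as in [gaussian_minors_rec]. *)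
Fixpoint good_heights (s : seq nat) : bool :=
  if s is l :: t then
    [&& all (fun c => c <= l)%N t,
        [forall k : 'I_l, ~~ (p %| 2 * count (fun c => (k < c)%N) t + (l - k))%N]
      & good_heights t]
  else true.

Let h := p./2.

(* Every height v with 1 <= v <= r occurs p./2 times, except that x occurs once less. *)
Fixpoint stairs r x : seq nat :=
  if r is r'.+1 then nseq (h - (x == r)) r ++ stairs r' x else [::].

Hypotheses (p_odd : odd p) (p_gt1 : (1 < p)%N).

Let hE : p = (2 * h).+1. Proof. by rewrite /h; lia. Qed.

Lemma stairs_le r x : all (fun c => c <= r)%N (stairs r x).
Proof.
elim: r => //= r IHr; rewrite all_cat all_nseq leqnn orbT /=.
by apply: sub_all IHr => c; apply: leqW.
Qed.

Lemma count_stairs r x k :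
  (count (fun c => (k < c)%N) (stairs r x) + ((k < x) && (x <= r)) = h * (r - k))%N.
Proof.
elim: r => [|r IHr] /=; first by lia.
rewrite count_cat count_nseq; case: (ltngtP x r.+1) => xr; move: IHr; nia.
Qed.

(** Since 2h = p - 1, a new column with e equal ones to its right has hook number p (r - k) + 2e + 1
    in row k, less 2 if the column removed by [x] reaches beyond row k. As e < h, neither 2e + 1 nor
    2e - 1 is divisible by p. *)
Lemma good_stairs_cat r x e : (e <= h)%N -> good_heights (stairs r x) ->
  good_heights (nseq e r.+1 ++ stairs r x).
Proof.
move=> + good_st; elim: e => [//|e IHe] eh /=; rewrite IHe 1?ltnW // andbT.
rewrite all_cat all_nseq leqnn orbT /=; apply/andP; split.
  by apply: sub_all (stairs_le r x) => c; apply: leqW.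
apply/forallP=> k; rewrite count_cat count_nseq ltn_ord mul1n.
have kr : (k <= r)%N by rewrite -ltnS.
have := count_stairs r x k; set b := (_ && _); set ct := count _ _ => ctE.
have [s [q [s_gt0 sp vE]]] : exists s q, [/\ (0 < s)%N, (s < p)%N
    & (2 * (e + ct) + (r.+1 - k) = q * p + s)%N].
  case: (boolP (b && (e == 0)%N)) => [/andP[bT /eqP e0]|nb].
    (* Here 2e - 1 is -1: the residue is p - 1 and the quotient drops by one. *)
    exists p.-1, (r - k).-1; split; [lia|lia|].
    have : (0 < r - k)%N by move: bT; rewrite /b; lia.
    move: ctE; rewrite bT e0; case: (r - k)%N (subnK kr) => // j; move: hE; nia.
  exists (2 * e + 1 - 2 * b)%N, (r - k)%N; split; [|move: hE; lia|move: hE; nia].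
  by move: nb; case: b ctE => /=; lia.
by rewrite vE /dvdn modnMDl modn_small // -lt0n.
Qed.

Lemma good_stairs r x : good_heights (stairs r x).
Proof. by elim: r => //= r IHr; apply: good_stairs_cat; rewrite ?leq_subr. Qed.

Lemma sumn_stairs r x : (x <= r)%N -> (sumn (stairs r x) + x = sumn (stairs r 0))%N.
Proof.
have h_gt0 : (0 < h)%N by move: hE p_gt1; lia.
have gen : (sumn (stairs r x) + (if x <= r then x else 0) = sumn (stairs r 0))%N.
  elim: r => [|r IHr] /=; first by case: x.
  rewrite !sumn_cat !sumn_nseq -IHr (leq_eqVlt x) ltnS.
  case: (eqVneq x r.+1) => [->|_] /=; rewrite !subn0; last by rewrite addnA.
  by rewrite ltnn addn0 addnAC -mulnSr subn1 prednK.
by move=> xr; rewrite xr in gen.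
Qed.

(** A full staircase up to height r, with e columns of height r+1 added and one of height x removed
    (none if x = 0), reaches every size. To increase m, lower x; once x is 0, add a column and
    remove one shorter by 1. *)
Lemma good_heights_ex m : exists2 s, good_heights s & sumn s = m.
Proof.
have h_gt0 : (0 < h)%N by move: hE p_gt1; lia.
suff [r [e [x [eh xr mE]]]] : exists r e x, [/\ (e <= h)%N, (x <= r)%N
    & (m + x = sumn (stairs r 0) + e * r.+1)%N].
  exists (nseq e r.+1 ++ stairs r x); first exact/good_stairs_cat/good_stairs.
  rewrite sumn_cat sumn_nseq mulnC; have := sumn_stairs xr; lia.
elim: m => [|m [r [e [x [eh xr mE]]]]]; first by exists 0, 0, 0.
case: x xr mE => [_ mE|x xr mE]; last first.
  by exists r, e, x; split=> //; [exact: ltnW | move: mE; rewrite addSn addnS].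
have [eh'|he] := ltnP e h; first by exists r, e.+1, r; split=> //; nia.
(* For e = h the columns of height r+1 complete the next staircase, so a column of height r+2 is
   added and one of height r+1 removed. *)
exists r.+1, 1, r.+1; split=> //=; rewrite sumn_cat sumn_nseq subn0.
nia.
Qed.

End Heights.

Lemma det_mxdiag (B : comNzRingType) m (q : 'I_m -> nat) (D : forall i, 'M[B]_(q i)) :
  \det (\mxdiag_i D i) = \prod_i \det (D i).
Proof.
elim: m q D => [|m IHm] q D.
  have det0 k (M : 'M[B]_k) : k = 0%N -> \det M = 1 by move=> k0; subst k; apply: det_mx00.
  by rewrite [RHS]big_ord0 det0 // big_ord0.
rewrite mxdiag_recl [RHS]big_ord_recl -IHm.
have det_castmx k k' (e1 e2 : k = k') (M : 'M[B]_k) : \det (castmx (e1, e2) M) = \det M.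
  by case: _ / e1 e2 => e2; rewrite castmx_id.
by rewrite det_castmx det_ublock.
Qed.

(** The column heights of 2 lambda, given those of lambda; this turns the minors into squares of
    minors. *)
Definition doubled (s : seq nat) : seq nat := flatten [seq [:: c; c] | c <- s].

Lemma sumn_doubled s : sumn (doubled s) = (2 * sumn s)%N.
Proof. by elim: s => //= c s ->; lia. Qed.

Lemma doubled_le s b : all (fun c => c <= b)%N s -> all (fun c => c <= b)%N (doubled s).
Proof. by elim: s => //= c s IHs /andP[-> /IHs->]. Qed.

Lemma good_heights_le p l s : good_heights p (l :: s) -> all (fun c => c <= l)%N (l :: s).
Proof. by case/and3P=> ls _ _ /=; rewrite leqnn. Qed.

(** * The invariant kernel on matchings *)

Section Kernel.

Local Notation mact := ('P^*^*)%act.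

Variables (F : fieldType) (p : nat).
Hypotheses (p_odd : odd p) (F_char : p \in [pchar F]).

Lemma gaussian_good_heights (B : comNzRingType) (N : nat) (g : nat -> nat -> B)
    (d : nat -> nat -> B -> B) (E : {additive B -> F}) (s : seq nat) :
  (forall i j x y, d i j (x + y) = d i j x + d i j y) ->
  (forall i j x y, d i j (x * y) = d i j x * y + x * d i j y) ->
  (forall i j k l, (i < N)%N -> (j < N)%N -> (k < N)%N -> (l < N)%N ->
     d i j (g k l) = ((k == i) && (l == j))%:R) ->
  (forall i j x, (i < N)%N -> (j < N)%N -> E (g i j * x) = E (d i j x)) ->
  E 1 = 1 -> all (fun c => c <= N)%N s -> good_heights p s ->
  E (\prod_(c <- doubled s) lead_minor g c) != 0.
Proof.
move=> dD dM dg Ep E1.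
have -> : \prod_(c <- doubled s) lead_minor g c = \prod_(c <- s) lead_minor g c ^+ 2.
  elim: s => [|c s IHs]; first by rewrite !big_nil.
  by rewrite [doubled _]/= !big_cons IHs expr2 mulrA.
elim: s => [|l t IHt]; first by rewrite big_nil E1 oner_neq0.
rewrite big_cons => /andP[lN tN] /and3P[tl /forallP pl gt].
rewrite (gaussian_minors_rec dD dM dg Ep lN tl) mulf_neq0 ?IHt //.
rewrite natr_prod; apply/prodf_neq0 => k _.
by rewrite -(dvdn_pcharf F_char) pl.
Qed.

Theorem matchings_kernel (T : finType) (A : {set T}) m : #|A| = (2 * m)%N ->
  exists (c : {set {set T}} -> {set {set T}} -> F) (x : {set {set T}} -> F) (th : F),
  [/\ forall P S s, perm_on A s -> c (mact P s) (mact S s) = c P S,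
      forall P S g, P \in matchings A -> S \in matchings A -> perm_on A g ->
        (g ^+ p = 1)%g -> g != 1%g -> mact P g = P -> mact S g = S -> c P S = 0,
      forall S, S \in matchings A ->
        \sum_(P in matchings A) x P * c P S = th * x S,
      th != 0 & exists2 P, P \in matchings A & x P != 0].
Proof.
move=> cardA; have p_gt1 : (1 < p)%N by case/andP: F_char => /prime_gt1.
have [s good_s sum_s] := good_heights_ex p_odd p_gt1 m.
pose L := doubled s; pose R := head 0 s.
have sR : all (fun c => c <= R.+1)%N s.
  rewrite /R; case: s good_s {sum_s L R} => // l t /good_heights_le; apply: sub_all => c.
  exact: leqW.
have LR : all (fun c => c <= R.+1)%N L := doubled_le sR.
pose q (i : 'I_(size L)) := nth 0 L i.
have qR i : (q i <= R.+1)%N by apply: (allP LR); rewrite mem_nth.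
pose K := (\sum_i q i)%N.
have KE : K = #|A|.
  rewrite cardA -sum_s -sumn_doubled sumnE -/L /K /q.
  by rewrite (big_nth 0) big_mkord.
pose io (i : 'I_K) : T := enum_val (cast_ord KE i).
have io_inj : injective io by move=> i j /enum_val_inj/cast_ord_inj.
have io_im : io @: setT = A.
  apply/setP=> y; apply/imsetP/idP=> [[i _ ->]|Ay]; first exact: enum_valP.
  exists (cast_ord (esym KE) (enum_rank_in Ay y)); rewrite ?inE //.
  by rewrite /io cast_ordKV enum_rankK_in.
(* Cells are numbered column by column: [sig1] is the column of a cell and [sig2] its position
   there. *)
pose row (i : 'I_K) : 'I_R.+1 := inord (order.tagnat.sig2 i).
pose col (i : 'I_K) := order.tagnat.sig1 i.
have rowE i : row i = order.tagnat.sig2 i :> nat.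
  by rewrite inordK // (leq_trans (ltn_ord _)).
have cell_inj i j : col i = col j -> row i = row j -> i = j.
  move=> cij rij; apply: val_inj => /=; rewrite -(order.tagnat.sig2K i) -(order.tagnat.sig2K j).
  by apply/eqP; rewrite order.tagnat.eq_Rank; apply/andP; split; [apply/eqP | rewrite -!rowE rij].
have cell_closed i (a : 'I_R.+1) : (a <= row i)%N -> exists2 j, col j = col i & row j = a.
  rewrite rowE => ai; have aq : (a < q (col i))%N := leq_ltn_trans ai (ltn_ord _).
  exists (@order.tagnat.Rank _ q (col i) (Ordinal aq)); first exact: order.tagnat.Rank1K.
  by apply: val_inj; rewrite /= rowE order.tagnat.Rank2K.
have [B [g [d [E [dD dM dg Ep E1]]]]] := gaussian_functional F R.+1.
(* In this numbering the matrix is block diagonal, and its blocks have the leading minors as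
   determinants. *)
have detE : col_det io row col g (row_word io row) = \prod_(c <- L) lead_minor g c.
  rewrite (big_nth 0%N) big_mkord -(det_mxdiag (fun i => \matrix_(a < q i, b < q i) g a b)).
  congr (\det _); apply/mxblockP => i j; rewrite mxblockK; apply/matrixP=> a b.
  rewrite !mxE (mkwordE io_inj) !rowE /col.
  have rank2 c (e : 'I_(q c)) : order.tagnat.sig2 (order.tagnat.Rank c e) = e :> nat.
    by rewrite order.tagnat.Rank2K.
  rewrite !rank2 !order.tagnat.Rank1K.
  case: (i =P j) => [ij|_]; last by rewrite mxE.
  by case: _ / ij b => b; rewrite conform_mx_id mxE.
have th_neq0 : E (col_det io row col g (row_word io row)) != 0.
  by rewrite detE (gaussian_good_heights dD dM dg Ep E1).
exists (wcount2 A (content row) F), (word_vector A io row col F),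
  (E (col_det io row col g (row_word io row)) ^+ 2).
split.
- by move=> P S s0 onA; apply: wcount2_mact.
- by move=> P S g0 MP MS onA gp ng Pg Sg; apply: (wcount2_eq0 _ p_odd F_char MP MS onA gp).
- by move=> S MS; apply: word_vector_wcount2.
- by rewrite expf_neq0.
exact: (word_vector_neq0 io_inj io_im cell_inj cell_closed dD dM dg Ep E1 th_neq0).
Qed.

End Kernel.

(** * The summand of the Foulkes module *)

(** [b] is supported on one chosen point of each orbit, with value c divided by the order of the
    stabiliser; the sum over [L] meets that point once for each element of the stabiliser. *)
Lemma orbit_average (F : fieldType) (p : nat) (gT : finGroupType) (L : {group gT})
    (X : finType) (to : {action gT &-> X}) (c : X -> F) :
  p \in [pchar F] -> (forall x l, l \in L -> c (to x l) = c x) ->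
  exists b : X -> F, forall x, ((p %| #|'C_L[x | to]|)%N -> c x = 0) ->
    \sum_(l in L) b (to x l^-1%g) = c x.
Proof.
move=> F_char cL.
pose rp x := odflt x [pick y in orbit to L x].
have rpE x y : y \in orbit to L x -> rp y = rp x.
  move=> yx; rewrite /rp (eq_pick (Q := mem (orbit to L x))); last first.
    by move=> z; rewrite /= (orbit_eqP yx).
  by case: pickP => // /(_ x); rewrite /= orbit_refl.
have rpP x : rp x \in orbit to L x.
  by rewrite /rp; case: pickP => // _; apply: orbit_refl.
have corb x y : y \in orbit to L x -> c y = c x by case/orbitP=> l Ll <-; apply: cL.
have stab x y : y \in orbit to L x -> #|'C_L[y | to]| = #|'C_L[x | to]|.
  move=> yx; have := card_orbit_stab to L x; rewrite -(card_orbit_stab to L y) (orbit_eqP yx).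
  by move/eqP; rewrite eqn_pmul2l => [/eqP//|]; apply/card_gt0P; exists x; apply: orbit_refl.
exists (fun x => (x == rp x)%:R * (c x / #|'C_L[x | to]|%:R)) => x cx0.
rewrite (reindex_inj invg_inj) /=; under eq_bigl do rewrite groupV.
under eq_bigr do rewrite invgK.
rewrite (eq_bigr (fun l => (to x l == rp x)%:R * (c x / #|'C_L[x | to]|%:R))) => [|l Ll]; last first.
  have xl : to x l \in orbit to L x by apply: mem_orbit.
  by rewrite (rpE _ _ xl) (corb _ _ xl) (stab _ _ xl).
rewrite -mulr_suml.
have -> : \sum_(l in L) (to x l == rp x)%:R = #|'C_L[x | to]|%:R :> F.
  have /orbitP[l0 Ll0 l0x] := rpP x.
  rewrite -(card_rcoset _ l0) -sum1_card natr_sum big_mkcond [RHS]big_mkcond /=.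
  apply: eq_bigr => l _; rewrite mem_rcoset inE groupMr ?groupV //.
  suff -> : (l * l0^-1 \in 'C[x | to])%g = (to x l == rp x) by case: (l \in L); case: eqP.
  apply/astab1P/eqP => e; rewrite -l0x in e *; last by rewrite actM e actK.
  by rewrite -[in RHS]e -actM mulgKV.
case: (boolP (p %| #|'C_L[x | to]|)%N) => [/cx0->|]; first by rewrite mul0r mulr0.
by rewrite (dvdn_pcharf F_char) => nz; rewrite mulrC divfK.
Qed.

(** * The standard pairs and the wreath product *)

Section StandardPairs.

Variables (n k : nat).
Hypothesis kn : (k <= n)%N.

Local Notation T := 'I_(2 * n).
Local Notation mact := ('P^*^*)%act.

Definition first_points : {set T} := [set x : T | (x < 2 * k)%N].

Definition half_block (i : nat) : {set T} := [set x : T | x./2 == i :> nat].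

Definition std_pairs : {set {set T}} := [set half_block (i : 'I_k) | i : 'I_k].

Local Notation Z := first_points.
Local Notation S0 := std_pairs.
Local Notation W := (wreath_S2_group n k).

Lemma std_pairsP (B : {set T}) :
  reflect (exists2 i, (i < k)%N & B = half_block i) (B \in S0).
Proof.
apply: (iffP imsetP) => [[i _ ->]|[i ik ->]]; first by exists i.
by exists (Ordinal ik).
Qed.

Lemma std_pairs_matching : S0 \in matchings Z.
Proof.
apply/matchingsP; split.
- apply/setP=> x; rewrite inE; apply/bigcupP/idP => [[B /std_pairsP[i ik ->]]|xk].
    by rewrite inE => /eqP; lia.
  exists (half_block x./2); last by rewrite inE.
  by apply/std_pairsP; exists x./2; first by lia.
- apply/trivIsetP=> B C /std_pairsP[i ik ->] /std_pairsP[j jk ->] nij.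
  apply/pred0P=> x /=; rewrite !inE; apply/negP=> /andP[/eqP xi /eqP xj].
  by rewrite -xi -xj eqxx in nij.
move=> B /std_pairsP[i ik ->].
have i0 : (2 * i < 2 * n)%N by lia.
have i1 : (2 * i + 1 < 2 * n)%N by lia.
have -> : half_block i = [set Ordinal i0; Ordinal i1].
  apply/setP=> x; rewrite !inE -!val_eqE /=; lia.
by rewrite cards2 -val_eqE /=; lia.
Qed.

Lemma card_first_points : #|Z| = (2 * k)%N.
Proof.
have kn2 : (2 * k <= 2 * n)%N by lia.
have inj : injective (widen_ord kn2) by move=> i j /(congr1 val) /= /val_inj.
rewrite -[RHS]card_ord -[RHS](card_imset _ inj).
apply: eq_card => x; rewrite inE; apply/idP/imsetP => [xk|[y _ ->]]; last exact: (ltn_ord y).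
by exists (Ordinal xk) => //; apply: val_inj.
Qed.

Lemma card_out_first_points : #|~: Z| = (2 * (n - k))%N.
Proof. by have := cardsC Z; rewrite card_first_points card_ord; lia. Qed.

Lemma std_pairs_act (s : 'S_(2 * n)) :
  (forall B, B \in S0 -> s @: B \in S0) -> mact S0 s = S0.
Proof.
move=> sS; apply/eqP; rewrite mactE eqEcard.
have injs : injective (fun B : {set T} => s @: B) by apply: imset_inj; apply: perm_inj.
rewrite (card_imset _ injs) leqnn andbT.
by apply/subsetP=> _ /imsetP[B SB ->]; apply: sS.
Qed.

Lemma wreath_on s : s \in W -> perm_on Z s.
Proof. by rewrite inE => /andP[]. Qed.

Lemma wreath_std_pairs s : s \in W -> mact S0 s = S0.
Proof.
rewrite inE => /andP[onZ /existsP[sg /existsP[ta /forallP sE]]].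
apply: std_pairs_act => _ /std_pairsP[i ik ->]; apply/std_pairsP.
exists (sg (Ordinal ik)); first exact: ltn_ord.
have Si : half_block i \in S0 by apply/std_pairsP; exists i.
have Ssi : half_block (sg (Ordinal ik)) \in S0.
  by apply/std_pairsP; exists (sg (Ordinal ik)); rewrite ?ltn_ord.
have /matchingsP[_ _ c2] := std_pairs_matching.
apply/eqP; rewrite eqEcard card_imset ?(c2 _ Si) ?(c2 _ Ssi) ?leqnn ?andbT; last exact: perm_inj.
apply/subsetP=> _ /imsetP[x + ->]; rewrite !inE => /eqP xi.
have b2 : (odd x < 2)%N by case: (odd x).
have /forallP/(_ (Ordinal ik))/forallP/(_ (Ordinal b2))/implyP := sE x.
have xE : (x == 2 * i + odd x :> nat)%N by apply/eqP; have := odd_double_half x; move: xi; lia.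
move=> /(_ xE)/eqP ->.
case: (fun_of_perm _ (Ordinal b2)) => c c_lt /=.
by rewrite mul2n halfD doubleK odd_double; case: c c_lt => [|[|]] //= _; rewrite ?addn0.
Qed.

Lemma std_pairs_half (s : 'S_(2 * n)) (x y : T) : mact S0 s = S0 -> x \in Z ->
  x./2 = y./2 -> (s x)./2 = (s y)./2.
Proof.
move=> sS Zx xy; have SB : half_block x./2 \in S0.
  by apply/std_pairsP; exists x./2 => //; move: Zx; rewrite inE; lia.
have : s @: half_block x./2 \in S0 by rewrite -sS mem_mact.
case/std_pairsP=> j _ e.
have hB z : z \in half_block x./2 -> (s z)./2 = j.
  by move=> /(imset_f s); rewrite e !inE => /eqP.
by rewrite !hB // !inE ?xy.
Qed.

(** With [wreath_std_pairs], identifies the wreath product as the stabiliser of the standard pairs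
    among permutations of the first points. The block permutation is read off the halves [x./2], the
    permutations inside blocks off the parities. *)
Lemma std_pairs_wreath (s : 'S_(2 * n)) : perm_on Z s -> mact S0 s = S0 -> s \in W.
Proof.
move=> onZ sS.
have sSV : mact S0 s^-1%g = S0 by rewrite -[in LHS]sS actK.
have pt_lt (i : 'I_k) (b : 'I_2) : (2 * i + b < 2 * n)%N.
  by have := ltn_ord i; have := ltn_ord b; lia.
pose pt i b : T := Ordinal (pt_lt i b).
have Zpt i b : pt i b \in Z by rewrite inE /=; have := ltn_ord i; have := ltn_ord b; lia.
have Zspt i b : s (pt i b) \in Z by rewrite perm_closed.
have half_pt i b : (pt i b)./2 = i by have := ltn_ord b; rewrite /=; lia.
have odd_pt i b : odd (pt i b) = b :> nat by have := ltn_ord b; rewrite /=; lia.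
have sg_lt (i : 'I_k) : ((s (pt i ord0))./2 < k)%N.
  by have := Zspt i ord0; rewrite inE; lia.
pose f (i : 'I_k) : 'I_k := Ordinal (sg_lt i).
have f_inj : injective f.
  move=> i j /(congr1 val) /= /(std_pairs_half sSV (Zspt i ord0)).
  by rewrite !permK !half_pt => /val_inj.
have odd_lt i b : (odd (s (pt i b)) < 2)%N by case: odd.
pose h i (b : 'I_2) : 'I_2 := Ordinal (odd_lt i b).
have half_s i b : (s (pt i b))./2 = f i.
  by apply: (std_pairs_half sS (Zpt i b)); rewrite !half_pt.
have h_inj i : injective (h i).
  move=> b b' /(congr1 val) /= e; apply: val_inj; rewrite /= -!(odd_pt i).
  have -> // : pt i b = pt i b'; apply: (@perm_inj _ s); apply: val_inj => /=.
  by rewrite -(odd_double_half (s (pt i b))) e !half_s -(half_s i b') odd_double_half.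
rewrite inE onZ; apply/existsP; exists (perm f_inj); apply/existsP.
exists [ffun i => perm (@h_inj i)]; apply/forallP=> x; apply/forallP=> i; apply/forallP=> b.
apply/implyP=> /eqP xE; have -> : x = pt i b by apply: val_inj.
rewrite ffunE !permE -(half_s i b) /=; apply/eqP.
by rewrite -[LHS]odd_double_half addnC -mul2n.
Qed.

Lemma half_block_eq (x y : T) B : B \in S0 -> x \in B -> (y \in B) = (x./2 == y./2).
Proof. by case/std_pairsP=> i _ ->; rewrite !inE => /eqP->; rewrite eq_sym. Qed.

(** Points of one block are exchanged by a transposition; otherwise their blocks are swapped,
    partner with partner. *)
Lemma wreath_transitive x y : x \in Z -> y \in Z -> exists2 s, s \in W & s x = y.
Proof.
move=> Zx Zy; have MS := std_pairs_matching.
case: (eqVneq x./2 y./2) => [xy|nxy].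
  exists (tperm x y); last exact: tpermL.
  apply: std_pairs_wreath.
    apply/subsetP=> z; rewrite inE; case: tpermP => [->|->|]; rewrite ?eqxx //.
  apply: std_pairs_act => B SB.
  suff -> : tperm x y @: B = B by [].
  apply/eqP; rewrite eqEcard card_imset ?leqnn ?andbT; last exact: perm_inj.
  apply/subsetP=> _ /imsetP[z Bz ->]; case: tpermP Bz => // -> Bz.
    by rewrite (half_block_eq _ SB Bz) xy.
  by rewrite (half_block_eq _ SB Bz) xy.
have [x' [Zx' nx' Sx]] := matchings_partner MS Zx.
have [y' [Zy' ny' Sy]] := matchings_partner MS Zy.
have hx : x'./2 = x./2 by apply/esym/eqP; rewrite -(half_block_eq _ Sx) ?set21 ?set22.
have hy : y'./2 = y./2 by apply/esym/eqP; rewrite -(half_block_eq _ Sy) ?set21 ?set22.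
have neq (a b : T) : a./2 != b./2 -> a != b by apply: contraNneq => ->.
have nxy' : x != y' by rewrite neq // hy.
have nx'y : x' != y by rewrite neq // hx.
have nx'y' : x' != y' by rewrite neq // hx hy.
have nxy0 : x != y by rewrite neq.
pose s := (tperm x y * tperm x' y')%g.
have sx : s x = y by rewrite permM tpermL tpermD // eq_sym.
have sy : s y = x by rewrite permM tpermR tpermD // eq_sym.
have sx' : s x' = y' by rewrite permM tpermD ?tpermL // eq_sym // eq_sym.
have sy' : s y' = x' by rewrite permM tpermD ?tpermR // eq_sym.
have sz z : z != x -> z != y -> z != x' -> z != y' -> s z = z.
  by move=> *; rewrite permM !tpermD // eq_sym.
exists s => //; apply: std_pairs_wreath.
  apply/subsetP=> z; rewrite inE; apply: contraR => nZ.
  by apply/eqP/sz; apply: contraNneq nZ => ->.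
apply: std_pairs_act => B SB.
case: (boolP (x \in B)) => [Bx|nBx].
  rewrite (matchings_block MS SB Sx Bx (set21 _ _)) imsetU !imset_set1 sx sx'.
  exact: Sy.
case: (boolP (y \in B)) => [By|nBy].
  rewrite (matchings_block MS SB Sy By (set21 _ _)) imsetU !imset_set1 sy sy'.
  exact: Sx.
suff -> : s @: B = B by [].
rewrite -[RHS]imset_id; apply: eq_in_imset => z Bz; apply: sz.
- by apply: contraNneq nBx => <-.
- by apply: contraNneq nBy => <-.
- by apply: contraNneq nBx => zx'; rewrite (half_block_eq _ SB Bz) zx' hx.
by apply: contraNneq nBy => zy'; rewrite (half_block_eq _ SB Bz) zy' hy.
Qed.

(** If [Q] fixed x, it would lie in the stabiliser of x, whose index is the orbit length 2k, a
    multiple of p; this contradicts the Sylow property. *)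
Lemma sylow_wreath_free (p : nat) (Q : {group 'S_(2 * n)}) x :
  prime p -> (p %| k)%N -> p.-Sylow(W) Q -> x \in Z -> exists2 q, q \in Q & q x != x.
Proof.
move=> p_pr pk sylQ Zx; apply/exists_inP; apply: contraT; rewrite negb_exists_in.
move=> /forall_inP fixQ; have [sQW _ p'WQ] := and3P sylQ.
have orbZ : orbit 'P W x = Z.
  apply/setP=> y; apply/orbitP/idP => [[s Ws <-]|Zy].
    by rewrite /= apermE perm_closed ?wreath_on.
  by have [s Ws sx] := wreath_transitive Zx Zy; exists s.
have sQx : Q \subset 'C_W[x | 'P].
  rewrite subsetI sQW; apply/subsetP=> q Qq; apply/astab1P.
  by rewrite /= apermE; apply/eqP; have := fixQ q Qq; rewrite negbK.
have pW : (p %| #|W : Q|)%N.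
  rewrite -(Lagrange_index _ sQx) ?subsetIl //.
  apply: dvdn_mulr; rewrite -card_orbit orbZ card_first_points.
  exact: dvdn_mull.
by move: p'WQ; rewrite p'natE // pW.
Qed.

End StandardPairs.

Section PairAction.

Variables (T : finType).
Local Notation mact := ('P^*^*)%act.

Definition mact2 (q : {set {set T}} * {set {set T}}) (s : {perm T}) :=
  (mact q.1 s, mact q.2 s).

Lemma mact2_is_action : is_action [set: {perm T}] mact2.
Proof.
apply: is_total_action => [q|q s u]; first by rewrite /mact2 !act1; case: q.
by rewrite /mact2 !actM.
Qed.

Canonical mact2_action := Action mact2_is_action.

End PairAction.

(** * Traces from the wreath product *)

Section Assembly.

Variables (F : fieldType) (p n k : nat).
Hypotheses (p_pr : prime p) (p_odd : odd p) (F_char : p \in [pchar F]).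
Hypotheses (kn : (k <= n)%N) (pk : (p %| k)%N).
Variable Q : {group 'S_(2 * n)}.
Hypothesis sylQ : p.-Sylow(wreath_S2_group n k) Q.

Local Notation T := 'I_(2 * n).
Local Notation mact := ('P^*^*)%act.
Local Notation Z := (first_points n k).
Local Notation A := (~: Z).
Local Notation S0 := (std_pairs n k).
Local Notation W := (wreath_S2_group n k).
Local Notation Om := (pair_partitions n).
Local Notation L := (@perm.Sym_group _ A).

Lemma mact_eq_in (B : {set T}) P (s u : 'S_(2 * n)) : P \in matchings B ->
  (forall x, x \in B -> s x = u x) -> mact P s = mact P u.
Proof.
move=> MP su; rewrite !mactE; apply: eq_in_imset => C PC; apply: eq_in_imset => x Cx.
by rewrite su // (subsetP (matchings_sub MP PC)).
Qed.

Lemma Sym_std (l : 'S_(2 * n)) : l \in L -> mact S0 l = S0.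
Proof.
rewrite inE => onA; apply: mact_id (std_pairs_matching kn) _ => x Zx.
by rewrite (out_perm onA) // inE negbK.
Qed.

Lemma rest_matching P : P \in Om -> S0 \subset P -> P :\: S0 \in matchings A.
Proof.
move=> OP sSP; rewrite -(setTD Z); exact: matchingsD (std_pairs_matching kn) OP sSP.
Qed.

Lemma dZA : [disjoint Z & A]. Proof. by rewrite -setI_eq0 setICr. Qed.

Lemma full_matching P : P \in matchings A -> S0 :|: P \in Om.
Proof. by move=> /(matchingsU dZA (std_pairs_matching kn)); rewrite setUCr. Qed.

Lemma rest_full P : P \in matchings A -> (S0 :|: P) :\: S0 = P.
Proof.
move=> MP; rewrite setDUl setDv set0U; apply/setDidPl.
by rewrite disjoint_sym (matchings_disjoint dZA (std_pairs_matching kn)).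
Qed.

Lemma wreath_rest P h : h \in W -> P \in matchings A -> mact P h = P.
Proof.
move=> Wh MP; apply: mact_id MP _ => x; rewrite inE => nZ.
by rewrite (out_perm (wreath_on Wh)).
Qed.

Lemma fix_over P h : h \in W -> P \in Om -> S0 \subset P -> mact P h = P.
Proof.
move=> Wh OP sSP; rewrite -(setID P S0) (setIidPr sSP) mactU.
by rewrite (wreath_std_pairs kn Wh) (wreath_rest Wh) ?rest_matching.
Qed.

Lemma Om_act P s : P \in Om -> mact P s \in Om.
Proof. by move=> OP; rewrite (acts_act (acts_pair_partitions n) (in_setT s)). Qed.

Variable b : {set {set T}} * {set {set T}} -> F.

Definition extend (P S : {set {set T}}) : F :=
  if (S0 \subset P) && (S0 \subset S) then b (P :\: S0, S :\: S0) else 0.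

Lemma extend_wreath h P S : h \in W -> P \in Om -> S \in Om ->
  extend (mact P h) (mact S h) = extend P S.
Proof.
move=> Wh OP OS; have S0h := wreath_std_pairs kn Wh.
rewrite /extend -{1 2}S0h !mactS; case: andP => // -[sP sS].
by rewrite -{1 2}S0h -!mactD !(wreath_rest Wh) ?rest_matching.
Qed.

(** Fixed cosets W g with a non-zero term are among the W l with l moving only points outside [Z]:
    being fixed makes g preserve [Z], the non-zero term makes it preserve the standard pairs, and g
    is then an element of W followed by such an l. *)
Lemma extend_trace P S : P \in Om -> S \in Om -> S0 \subset P ->
  \sum_(X in rcosets W [set: 'S_(2 * n)] | X \in 'Fix_('Rs)(Q))
     extend (mact P (repr X)^-1%g) (mact S (repr X)^-1%g)
  = if S0 \subset S then
      \sum_(l in L) b (mact (P :\: S0) l^-1%g, mact (S :\: S0) l^-1%g)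
    else 0.
Proof.
move=> OP OS sSP; have sQW := pHall_sub sylQ.
pose img := [set W :* l | l in L].
transitivity (\sum_(X in img) extend (mact P (repr X)^-1%g) (mact S (repr X)^-1%g)).
  rewrite (bigID (mem img)) /= [X in _ + X]big1 ?addr0 => [|X].
    apply: eq_bigl => X; case: (boolP (X \in img)); rewrite ?andbF // andbT.
    case/imsetP=> l Ll ->; apply/andP; split; first by apply/rcosetsP; exists l; rewrite ?inE.
    apply/afixP=> q Qq; rewrite /= rcosetE -rcosetM.
    have Wq := subsetP sQW q Qq; have onA : perm_on A l by rewrite inE in Ll.
    have dAZ : [disjoint A & Z] by rewrite disjoint_sym dZA.
    by rewrite (perm_onC onA (wreath_on Wq) dAZ) rcosetM rcoset_id.
  case/andP=> /andP[/(rcosets_repr (subsetT _))[_ defX] /afixP fixX]; apply: contraNeq.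
  rewrite {1}/extend; case: andP => [[sSPX _] _|]; last by rewrite eqxx.
  move: (repr X) defX sSPX => g defX sSPX.
  have conjW q : q \in Q -> (g * q * g^-1)%g \in W.
    move=> Qq; rewrite -mem_rcoset -defX -(fixX q Qq) /= rcosetE mem_rcoset mulgK.
    by rewrite defX rcoset_refl.
  (* If g^-1 sent z outside [Z], then g q g^-1, lying in [W], would fix g^-1 z, so q would fix z. *)
  have gVZ z : z \in Z -> (g^-1)%g z \in Z.
    move=> Zz; have [q Qq qz] := sylow_wreath_free kn p_pr pk sylQ Zz.
    apply: contraNT qz => nZ; have := out_perm (wreath_on (conjW q Qq)) nZ.
    by rewrite !permM permKV => /perm_inj->.
  have gZ : g @: Z = Z.
    have gVZ' : (g^-1)%g @: Z = Z.
      apply/eqP; rewrite eqEcard card_imset ?leqnn ?andbT; last exact: perm_inj.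
      by apply/subsetP=> _ /imsetP[z Zz ->]; apply: gVZ.
    by rewrite -{1}gVZ' -imset_comp -[RHS]imset_id; apply: eq_imset => z /=; rewrite permKV.
  have sSgP : mact S0 g \subset P by rewrite -(actKV 'P^*^* g P) mactS.
  (* The image of a standard pair lies in P and meets [Z], hence meets a standard pair, also in P;
     blocks of P that meet are equal. *)
  have S0g : mact S0 g = S0.
    apply: std_pairs_act => B SB; have gB : g @: B \in P by rewrite (subsetP sSgP) ?mem_mact.
    have /matchingsP[covS _ S2] := std_pairs_matching kn.
    have /card_gt0P[x Bx] : (0 < #|B|)%N by rewrite S2.
    have : g x \in cover S0.
      rewrite covS -gZ imset_f // -covS; by apply/bigcupP; exists B.
    case/bigcupP=> C SC Cgx.
    by rewrite (matchings_block OP gB (subsetP sSP _ SC) (imset_f g Bx) Cgx).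
  pose g1 := restr_perm Z g.
  have g1E x : x \in Z -> g1 x = g x.
    apply: restr_permE; rewrite !inE; apply/subsetP=> y Zy.
    by rewrite inE /= apermE -gZ imset_f.
  have Wg1 : g1 \in W.
    apply: (std_pairs_wreath kn); first exact: restr_perm_on.
    by rewrite (mact_eq_in (std_pairs_matching kn) g1E).
  apply/imsetP; exists (g1^-1 * g)%g; last by rewrite rcosetM rcoset_id ?groupV.
  rewrite inE; apply/subsetP=> x; rewrite !inE; apply: contraNN => xk.
  have Zx : x \in Z by rewrite inE.
  rewrite permM -g1E ?permKV //.
  by rewrite perm_closed // perm_onV // restr_perm_on.
(* The cosets W l are distinct, since a permutation supported both on [Z] and on its complement is
   trivial. *)
rewrite big_imset /=; last first.
  move=> l1 l2 /=; rewrite !inE => on1 on2 e.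
  have : l1 \in W :* l2 by rewrite -e rcoset_refl.
  rewrite mem_rcoset => /wreath_on onZ.
  have onA : perm_on A (l1 * l2^-1)%g by rewrite perm_onM ?perm_onV.
  suff l12 : (l1 * l2^-1 = 1)%g by rewrite -(mulgKV l2 l1) l12 mul1g.
  apply/permP=> x; rewrite perm1; case: (boolP (x \in Z)) => Zx.
    by rewrite (out_perm onA) // in_setC negbK.
  by rewrite (out_perm onZ).
have step l : l \in L -> extend (mact P (repr (W :* l))^-1%g) (mact S (repr (W :* l))^-1%g)
    = extend (mact P l^-1%g) (mact S l^-1%g).
  move=> Ll; have /rcosetP[h Wh ->] := mem_repr_rcoset W l.
  by rewrite invMg !actM; apply: extend_wreath; rewrite ?groupV //; apply: Om_act.
rewrite (eq_bigr _ step).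
have stepl l : l \in L -> extend (mact P l^-1%g) (mact S l^-1%g)
    = if S0 \subset S then b (mact (P :\: S0) l^-1%g, mact (S :\: S0) l^-1%g) else 0.
  move=> Ll; have S0l : mact S0 l^-1%g = S0 by rewrite Sym_std ?groupV.
  by rewrite /extend -{1 2}S0l !mactS sSP /= !mactD S0l.
rewrite (eq_bigr _ stepl); case: ifP => // _.
by rewrite big1.
Qed.

Lemma sum_over_std_pairs (f : {set {set T}} -> F) :
  \sum_(P in Om | S0 \subset P) f (P :\: S0) = \sum_(P in matchings A) f P.
Proof.
rewrite (reindex_onto (fun P => S0 :|: P) (fun P => P :\: S0)) /=; last first.
  by move=> P /andP[OP sSP]; rewrite -[RHS](setID P S0) (setIidPr sSP).
apply: eq_big => [P|P MP]; last first.
  by case/andP: MP => _ /eqP->.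
apply/idP/idP => [/andP[/andP[OP sSP] /eqP <-]|MP]; first exact: rest_matching.
by rewrite full_matching // subsetUl rest_full // eqxx.
Qed.

End Assembly.

Theorem theorem1p1 (p : nat) (p_prime : prime p) (p_odd : odd p)
    (F : fieldType) (F_char : p \in [pchar F]) (n t : nat) (t_le : (t * p <= n)%N)
    (Q : {group 'S_(2 * n)}) (Q_Qt : is_Qt p t Q) :
  exists (U : 'M[F]_#|pair_partitions n|)
         (modU : mxmodule (foulkes_repr n F) U),
    [/\ direct_summand (foulkes_repr n F) U,
        indecomposable (submod_repr modU) &
        is_vertex (submod_repr modU) Q].
Proof.
set k := (t * p)%N in t_le; have pk : (p %| k)%N by apply: dvdn_mull.
have sylQ : p.-Sylow(wreath_S2_group n k) Q.
  (* For t = 0 the wreath product is trivial and the trivial group is its Sylow subgroup, so both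
     cases of [is_Qt] become one. *)
  case: t @k t_le Q_Qt pk => [|t] k t_le /= Q_Qt _; last exact: Q_Qt.
  have W1 : wreath_S2_group n k :=: 1%g.
    apply/trivgP/subsetP=> s /wreath_on onZ; apply/set1P/permP=> z.
    by rewrite perm1 (out_perm onZ) // inE.
  by rewrite pHallE W1 Q_Qt subxx cards1 part_pnat_id.
pose A := ~: first_points n k; pose S0 := std_pairs n k.
have [c [x [th [c_inv c0 x_eig th0 [P0 MP0 xP0]]]]] :=
  matchings_kernel p_odd F_char (card_out_first_points t_le).
pose c2 (q : {set {set 'I_(2 * n)}} * {set {set 'I_(2 * n)}}) : F :=
  if (q.1 \in matchings A) && (q.2 \in matchings A) then c q.1 q.2 else 0.
have mact_mem P l : perm_on A l -> (('P^*^*)%act P l \in matchings A) = (P \in matchings A).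
  move=> onA; apply/idP/idP=> MP; last by rewrite -(perm_on_imset onA) mact_matchings.
  by rewrite -(actK 'P^*^* l P) -(perm_on_imset (perm_onV onA)) mact_matchings.
have c2_inv q l : l \in perm.Sym A -> c2 (mact2 q l) = c2 q.
  by rewrite inE => onA; rewrite /c2 /= !mact_mem // c_inv.
have [b b_avg] := @orbit_average F p _ (@perm.Sym_group _ A) _ (@mact2_action 'I_(2 * n)) c2
  F_char c2_inv.
have bE P S : P \in matchings A -> S \in matchings A ->
    \sum_(l in perm.Sym A) b (('P^*^*)%act P l^-1%g, ('P^*^*)%act S l^-1%g) = c P S.
  (* If p divides the order of the stabiliser of the pair, Cauchy's theorem gives an element of
     order p fixing both matchings, and [c0] applies. *)
  move=> MP MS; have := b_avg (P, S); rewrite /c2 /= MP MS; apply => /(Cauchy p_prime)[g].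
  case/setIP=> Lg /astab1P[Pg Sg] og; rewrite inE in Lg.
  apply: c0 MP MS Lg _ _ Pg Sg; first by rewrite -og expg_order.
  by rewrite -order_eq1 og; case: eqP p_prime => // ->.
pose w (P : {set {set 'I_(2 * n)}}) : F := if S0 \subset P then x (P :\: S0) else 0.
have [sQW pQ p'WQ] := and3P sylQ.
have sumS := sum_over_std_pairs t_le.
apply: (@perm_summand_with_vertex F p F_char _ _ _ _ _ (acts_pair_partitions n) Q (subsetT Q) pQ
  (wreath_S2_group n k) (extend k b) w th sQW (subsetT _)) => //.
- by rewrite -p'natE.
- by move=> h P S Wh OP OS; apply: extend_wreath.
- move=> P OP; rewrite /w; case: ifP => // sSP; case/negP; apply/afixP=> q Qq.
  by apply: (fix_over t_le (subsetP sQW q Qq)).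
- move=> S OS fS.
  (* On matchings extending [S0], [extend_trace] and [bE] turn the kernel into [c] on the remaining
     pairs; what is left is the eigenvalue equation of [x]. *)
  rewrite (eq_bigr (fun P : {set {set 'I_(2 * n)}} => if S0 \subset P then
      (if S0 \subset S then x (P :\: S0) * c (P :\: S0) (S :\: S0) else 0) else 0)); last first.
    move=> P OP; rewrite /w; case: ifP => sSP; last by rewrite mul0r.
    rewrite (extend_trace p_prime t_le pk sylQ b OP OS sSP).
    by case: ifP => sSS; rewrite ?mulr0 // bE // rest_matching.
  rewrite -big_mkcondr
    (sumS _ (fun P : {set {set 'I_(2 * n)}} => if S0 \subset S then x P * c P (S :\: S0) else 0)) /w.
  case: ifP => sSS; last by rewrite big1 ?mulr0.
  by rewrite x_eig // rest_matching.
exists (S0 :|: P0); first exact: full_matching.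
by rewrite /w subsetUl rest_full.
Qed.
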